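(* Let $\mathcal{F}=\{f_1,\dots,f_T\}\subseteq\mathbb{R}^n$ be a finite set such that $0\in\operatorname{int}(\operatorname{conv}\mathcal{F})$ and such that $\Phi^{\mathcal{F}}(z)$ has full row rank for all $z\in\mathbb{R}^n$. Define $\mathcal{S}(z):=z+\operatorname{conv}\mathcal{F}$. Consider an initial point $z_0\in\mathbb{R}^n$ and suppose that the measurements $(Y_0,\Phi^{\mathcal{F}}(z_0))$ are such that $\phi^\gamma$ is strictly convex for all $\gamma\in\Gamma_0$. For $j\geq 1$, repeat the following two steps iteratively: first update the candidate optimizer $$z_j:=\operatorname*{arg\,min}_{z\in\mathcal{S}(z_{j-1})}\phi^+(z;\Gamma_0\cap\dots\cap\Gamma_{j-1}),$$ and secondly collect measurements $Y_j=\hat\gamma^\top\Phi^{\mathcal{F}}(z_j)+W_j$ and define $\Gamma_j:=\mathcal{Z}(N_j)$. Suppose in addition that for $j\geq 1$ the measurements are such that $W_j^\top\sim\operatorname{Uni}(\mathcal{Z}(\Pi))$, and that, for a constant $a>0$, $\sigma_-(\Phi^{\mathcal{F}}(z))\geq a$ for all $z\in\mathbb{R}^n$. Then for any $z\in\mathbb{R}^n$, the expected value of the uncertainty monotonically converges to $0$, that is, for $j\geq 1$, $$U(z;\Gamma_0\cap\dots\cap\Gamma_{j-1})\geq U(z;\Gamma_0\cap\dots\cap\Gamma_j),$$ and $$\lim_{j\to\infty}\mathbb{E}\big(U(z;\Gamma_0\cap\dots\cap\Gamma_j)\big)=0.$$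
   Context: Conventions: $\operatorname{conv}$ and $\operatorname{int}$ denote convex hull and interior; $\sigma_-(M)$ denotes the smallest singular value of $M$; $\mathbb{E}$ denotes expected value. For a matrix $P$, $P\geq 0$ (resp. $P>0$) means that $P$ is symmetric positive semidefinite (resp. definite); $P<0$ means $-P>0$. Let $\phi_1,\dots,\phi_k:\mathbb{R}^n\to\mathbb{R}$ be known basis functions, $b(z):=(\phi_1(z),\dots,\phi_k(z))^\top\in\mathbb{R}^k$, and for $\gamma\in\mathbb{R}^k$ let $\phi^\gamma(z):=\gamma^\top b(z)$. The unknown true function is $\hat\phi=\phi^{\hat\gamma}$ for an unknown parameter $\hat\gamma\in\mathbb{R}^k$. For $\Gamma'\subseteq\mathbb{R}^k$ define $\phi^+(z;\Gamma'):=\sup_{\gamma\in\Gamma'}\phi^\gamma(z)$, $\phi^-(z;\Gamma'):=\inf_{\gamma\in\Gamma'}\phi^\gamma(z)$, and the uncertainty at $z$ by $U(z;\Gamma'):=\phi^+(z;\Gamma')-\phi^-(z;\Gamma')$. For a symmetric matrix $\Pi=\begin{bmatrix}\Pi_{11}&\Pi_{12}\\ \Pi_{21}&\Pi_{22}\end{bmatrix}\in\mathbb{R}^{(1+\ell)\times(1+\ell)}$ with $\Pi_{11}\in\mathbb{R}$, $\Pi_{22}\in\mathbb{R}^{\ell\times\ell}$, define $\mathcal{Z}(\Pi):=\{v\in\mathbb{R}^\ell \mid \begin{bmatrix}1\\ v\end{bmatrix}^\top\Pi\begin{bmatrix}1\\ v\end{bmatrix}\geq 0\}$; if $\Pi_{22}<0$,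 the Schur complement is $\Pi|\Pi_{22}:=\Pi_{11}-\Pi_{12}\Pi_{22}^{-1}\Pi_{21}$. Standing assumption on the noise model: $\Pi\in\mathbb{R}^{(1+T)\times(1+T)}$ is symmetric with $\Pi_{22}<0$ and $\Pi|\Pi_{22}\geq 0$ (so $\mathcal{Z}(\Pi)$ is nonempty, convex and bounded), and all noise samples lie in $\mathcal{Z}(\Pi)$. Uniform noise: $W^\top\sim\operatorname{Uni}(\mathcal{Z}(\Pi))$ means that $W$ is distributed over $\mathbb{R}^T$ with probability density $p(W)=1/\mu(\mathcal{Z}(\Pi))$ if $W^\top\in\mathcal{Z}(\Pi)$ and $p(W)=0$ otherwise, where $\mu$ is the (Lebesgue) measure on $\mathbb{R}^T$ (so that $\mu(\mathcal{Z}(\Pi))>0$ is implicit). For $\mathcal{F}=\{f_1,\dots,f_T\}\subseteq\mathbb{R}^n$ and $z\in\mathbb{R}^n$ let $\Phi^{\mathcal{F}}(z):=[\,b(z+f_1)\ \cdots\ b(z+f_T)\,]\in\mathbb{R}^{k\times T}$. At each step $j\geq 0$ the measurements are $Y_j=\hat\gamma^\top\Phi^{\mathcal{F}}(z_j)+W_j\in\mathbb{R}^{1\times T}$ with $W_j^\top\in\mathcal{Z}(\Pi)$. The set of parameters compatible with the $j$-th set of measurements is $\Gamma_j:=\mathcal{Z}(N_j)\subseteq\mathbb{R}^k$, where $$N_j:=\begin{bmatrix}1&Y_j\\0&-\Phi^{\mathcal{F}}(z_j)\end{bmatrix}\Pi\begin{bmatrix}1&Y_j\\0&-\Phi^{\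mathcal{F}}(z_j)\end{bmatrix}^\top.$$
   Formalization: The noise vectors W_0, W_1, W_2, … are assumed mutually independent; without independence the limit claim is false (for example when all W_j with j ≥ 1 are equal to one uniform vector). *)

(* Defs.v *)
From HB Require Import structures.
From mathcomp Require Import all_boot all_order all_algebra.
From mathcomp Require Import all_classical all_reals all_analysis.

Set Implicit Arguments.
Unset Strict Implicit.
Unset Printing Implicit Defensive.

Import Order.TTheory GRing.Theory Num.Theory.
Import numFieldNormedType.Exports.

Local Open Scope classical_set_scope.
Local Open Scope ring_scope.

Section Matrices.
Context {R : realType}.

Definition psd n (M : 'M[R]_n) : Prop :=
  M^T = M /\ forall x : 'cV[R]_n, 0 <= (x^T *m M *m x) 0 0.

Definition pd n (M : 'M[R]_n) : Prop :=
  M^T = M /\ forall x : 'cV[R]_n, x != 0 -> 0 < (x^T *m M *m x) 0 0.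

(* The singular values of an m x n matrix are the square roots of the
   eigenvalues of the smaller of its two Gram matrices, so that there are
   min(m, n) of them counted with multiplicity. *)
Definition singular_values m n (M : 'M[R]_(m, n)) : set R :=
  [set Num.sqrt a | a in [set a | if (m <= n)%N then eigenvalue (M *m M^T) a
                                  else eigenvalue (M^T *m M) a]].

(* The set of singular values is finite, so the infimum is a minimum as soon
   as 0 < min(m, n). *)
Definition sigma_min m n (M : 'M[R]_(m, n)) : R := inf (singular_values M).

Definition schur l (Pi : 'M[R]_(1 + l)) : R :=
  (ulsubmx Pi - ursubmx Pi *m invmx (drsubmx Pi) *m dlsubmx Pi) 0 0.

Definition Zset l (Pi : 'M[R]_(1 + l)) : set 'cV[R]_l :=
  [set v | 0 <= ((col_mx 1%:M v)^T *m Pi *m col_mx 1%:M v) 0 0].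

End Matrices.

Section Convexity.
Context {R : realType} {n : nat}.

Definition conv_hull (A : set 'cV[R]_n) : set 'cV[R]_n :=
  smallest (@convex_set R _) A.

Definition strictly_convex (g : 'cV[R]_n -> R) : Prop :=
  forall (x y : 'cV[R]_n) (t : R), x != y -> 0 < t < 1 ->
    g (t *: x + (1 - t) *: y) < t * g x + (1 - t) * g y.

Definition is_argmin (g : 'cV[R]_n -> \bar R) (S : set 'cV[R]_n)
    (x : 'cV[R]_n) : Prop :=
  S x /\ forall y, S y -> (g x <= g y)%E.

End Convexity.

Section Model.
Context {R : realType} {n k : nat}.
Variable phi : 'I_k -> 'cV[R]_n -> R.

Definition basis (z : 'cV[R]_n) : 'cV[R]_k := \col_i phi i z.

Definition phi_of (gamma : 'cV[R]_k) (z : 'cV[R]_n) : R :=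
  (gamma^T *m basis z) 0 0.

(* Suprema and infima are taken in the extended reals, so that no default
   value is involved when the parameter set is empty or unbounded. *)
Definition phi_plus (G : set 'cV[R]_k) (z : 'cV[R]_n) : \bar R :=
  ereal_sup [set (phi_of gamma z)%:E | gamma in G].

Definition phi_minus (G : set 'cV[R]_k) (z : 'cV[R]_n) : \bar R :=
  ereal_inf [set (phi_of gamma z)%:E | gamma in G].

Definition uncertainty (z : 'cV[R]_n) (G : set 'cV[R]_k) : \bar R :=
  (phi_plus G z - phi_minus G z)%E.

Definition PhiF T (f : 'I_T -> 'cV[R]_n) (z : 'cV[R]_n) : 'M[R]_(k, T) :=
  \matrix_(i, j) basis (z + f j) i 0.

Definition Nmx T (Pi : 'M[R]_(1 + T)) (Y : 'rV[R]_T) (Ph : 'M[R]_(k, T)) :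
    'M[R]_(1 + k) :=
  block_mx 1%:M Y 0 (- Ph) *m Pi *m (block_mx 1%:M Y 0 (- Ph))^T.

End Model.

Section PowerMeasure.
Local Open Scope ereal_scope.
Context d (X : measurableType d) (R : realType).
Variable m : {sigma_finite_measure set X -> \bar R}.

Definition cons_pair n (p : X * n.-tuple X) : n.+1.-tuple X :=
  [the n.+1.-tuple X of p.1 :: p.2].

Definition uncons n (t : n.+1.-tuple X) : X * n.-tuple X :=
  (thead t, [tuple of behead t]).

Lemma measurable_cons_pair n : measurable_fun setT (@cons_pair n).
Proof. exact: measurable_cons. Qed.

Lemma measurable_uncons n : measurable_fun setT (@uncons n).
Proof.
apply: measurable_fun_pair; first exact: measurable_tnth.
exact: measurable_behead.
Qed.

Lemma cons_pairK n : cancel (@cons_pair n) (@uncons n).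
Proof. by move=> [x t]; congr pair; apply: val_inj. Qed.

Section Cons.
Variables (n : nat) (mu : {sigma_finite_measure set (n.-tuple X) -> \bar R}).

Definition cons_measure : set (n.+1.-tuple X) -> \bar R :=
  pushforward (m \x mu) (@cons_pair n).

Let cons_measure0 : cons_measure set0 = 0.
Proof. by rewrite /cons_measure /pushforward preimage_set0 measure0. Qed.

Let preimage_cons_pair (A : set (n.+1.-tuple X)) :
  measurable A -> measurable (@cons_pair n @^-1` A).
Proof.
by move=> mA; rewrite -[_ @^-1` _]setTI; exact: measurable_cons_pair.
Qed.

Let cons_measure_ge0 A : 0 <= cons_measure A.
Proof. exact: (@measure_ge0 _ _ _ (m \x mu)). Qed.

Let cons_measure_sigma_additive : semi_sigma_additive cons_measure.
Proof.
move=> F mF tF mUF; rewrite /cons_measure /pushforward preimage_bigcup.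
apply: measure_semi_sigma_additive.
- by move=> i; exact: preimage_cons_pair.
- apply/trivIsetP => /= i j _ _ ij; rewrite -preimage_setI.
  by move/trivIsetP : tF => /(_ _ _ _ _ ij) ->//; rewrite preimage_set0.
- by rewrite -preimage_bigcup; exact: preimage_cons_pair.
Qed.

HB.instance Definition _ := isMeasure.Build _ _ _ cons_measure
  cons_measure0 cons_measure_ge0 cons_measure_sigma_additive.

Let cons_measure_sigma_finite : sigma_finite setT cons_measure.
Proof.
have /sigma_finiteP[F [UF ndF Foo]] := sigma_finiteT m.
have /sigma_finiteP[G [UG ndG Goo]] := sigma_finiteT mu.
exists (fun i => @uncons n @^-1` (F i `*` G i)).
  rewrite -preimage_bigcup (_ : \bigcup_i _ = setT) ?preimage_setT//.
  apply/seteqP; split => // -[x t] _.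
  have [i _ Fx] : (\bigcup_i F i) x by rewrite -UF.
  have [j _ Gt] : (\bigcup_i G i) t by rewrite -UG.
  exists (maxn i j) => //; split.
    by move: x Fx; exact/subsetPset/ndF/leq_maxl.
  by move: t Gt; exact/subsetPset/ndG/leq_maxr.
move=> i; have [mF Fi] := Foo i; have [mG Gi] := Goo i; split.
  rewrite -[_ @^-1` _]setTI; apply: measurable_uncons => //.
  exact: measurableX.
rewrite /cons_measure /pushforward (_ : _ @^-1` _ = F i `*` G i).
  by rewrite product_measure1E// lte_mul_pinfty// ge0_fin_numE.
rewrite -comp_preimage (_ : _ \o _ = id) ?preimage_id//.
by apply/funext => x /=; rewrite cons_pairK.
Qed.

HB.instance Definition _ := Measure_isSigmaFinite.Build _ _ _
  cons_measure cons_measure_sigma_finite.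

End Cons.

Fixpoint power_measure n : {sigma_finite_measure set (n.-tuple X) -> \bar R} :=
  match n with
  | 0%N => \d_([tuple] : 0.-tuple X)
  | n'.+1 => cons_measure (power_measure n')
  end.

End PowerMeasure.

(* R^T is represented by tuples where measurability matters: they carry the
   product sigma-algebra, i.e. the Borel sets of R^T. *)
Definition Rtuple (R : realType) (T : nat) : measurableType _ :=
  T.-tuple (measurableTypeR R).

Definition lebesgue_tuple (R : realType) (T : nat) :
    {sigma_finite_measure set (Rtuple R T) -> \bar R} :=
  power_measure (@lebesgue_measure R) T.

Definition row_of_tuple (R : realType) (T : nat) (w : Rtuple R T) : 'rV[R]_T :=
  \row_i tnth w i.

Section Probability.
Local Open Scope ereal_scope.
Context {R : realType} {T : nat} {d : measure_display}.
Context {Omega : measurableType d} (P : probability Omega R).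

(* W^T ~ Uni(Z): the law of the row vector W has density 1/mu(Z) on
   {W | W^T in Z} and 0 elsewhere, mu being the Lebesgue measure on R^T. *)
Definition uniform_on (W : {RV P >-> Rtuple R T}) (Z : set 'cV[R]_T) : Prop :=
  let mu := lebesgue_tuple R T in
  let Zt := [set w : Rtuple R T | Z (row_of_tuple w)^T%R] in
  0 < mu Zt < +oo /\
  forall A : set (Rtuple R T), measurable A ->
    distribution P W A = \int[mu]_(w in A) ((fine (mu Zt))^-1 * \1_Zt w)%:E.

Definition mutually_independent (W : nat -> {RV P >-> Rtuple R T}) : Prop :=
  forall (s : seq nat) (A : nat -> set (Rtuple R T)),
    uniq s -> (forall j, measurable (A j)) ->
    P (\bigcap_(j in [set` s]) (W j @^-1` A j)) =
    \prod_(j <- s) P (W j @^-1` A j).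

End Probability.

(* Main.v *)
Require Import Defs.
From HB Require Import structures.
From mathcomp Require Import all_boot all_order all_algebra.
From mathcomp Require Import all_classical all_reals all_analysis.
From mathcomp Require Import measurable_realfun.
From mathcomp Require Import ring lra.

Import Order.TTheory GRing.Theory Num.Theory.
Import numFieldNormedType.Exports.

Local Open Scope classical_set_scope.
Local Open Scope ring_scope.

Set Implicit Arguments.
Unset Strict Implicit.
Unset Printing Implicit Defensive.

(** Write Phi for the matrix of regressors at step j. A parameter g is compatible
    with step j iff W_j + Phi^T (gamma_hat - g) belongs to the ellipsoid Z. Since
    the smallest singular value of Phi is at least a, for each coordinate i there
    is u with Phi u = e_i and entries bounded by 1/a [bounded_right_inverse].
    Pairing the membership above with u gives
<<
      (gamma_hat - g)_i <= sup_Z <u, .> - <u, W_j>,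
>>
    so that the i-th error of every compatible parameter is at most delta as soon
    as W_j falls in the cap of Z where <u, .> is within delta of its supremum.
    This cap contains a box whose size depends only on Z, a and delta [Zset_cap],
    hence a uniform W_j falls in it with a probability at least p > 0 whatever u
    is [likely_cap]. The direction u is determined by the past and W_j is
    independent of the past, so the probability of missing the cap J times in a
    row is at most (1 - p)^J [past_decay, coordinate_decay]. Doing this for the
    2k signed coordinates bounds the uncertainty by a multiple of delta outside
    an event of vanishing probability; on that event it remains bounded
    [param_bound], and the expectation tends to 0.

    The delicate point is that u must be a measurable function of the past
    noise, while z_j is only given as a minimiser. Strict convexity makes this
    minimiser unique, and a unique minimiser of a function that is continuous in
    the point and measurable in the sample is measurable [measurable_argmin];
    the function minimised, a supremum over the random compact set of compatible
    parameters, is measurable for a similar reason [measurable_max_on]. The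
    argument uses the continuity of the basis functions. It is a consequence of
    the strict convexity hypothesis as soon as, for some sample, Gam_0 has two
    points [basis_continuous]; otherwise the uncertainty vanishes identically.

    Monotonicity holds because intersecting with one more set shrinks the set
    of parameters. *)

(** * Vectors and the sup norm *)

Section MatrixNorm.
Context {R : realType}.

Lemma coord_le_norm m n (x : 'M[R]_(m, n)) i j : `|x i j| <= `|x|.
Proof. by rewrite [leRHS]/Num.norm/= mx_normrE; apply/bigmax_geP; right; exists (i, j). Qed.

Lemma norm_le_coord m n (x : 'M[R]_(m, n)) e :
  0 <= e -> (forall i j, `|x i j| <= e) -> `|x| <= e.
Proof.
by move=> e0 xe; rewrite /Num.norm/= mx_normrE; apply/bigmax_leP; split => // -[].
Qed.

Lemma norm_trmx m n (x : 'M[R]_(m, n)) : `|x^T| = `|x|.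
Proof.
apply/eqP; rewrite eq_le; apply/andP; split; apply: norm_le_coord => // i j.
  by rewrite mxE coord_le_norm.
by have := coord_le_norm x^T j i; rewrite mxE.
Qed.

Lemma mx_continuousP m n (V : normedModType R) (f : 'M[R]_(m, n) -> V) v :
  {for v, continuous f} <->
  (forall e, 0 < e -> exists2 r, 0 < r & forall w, `|v - w| < r -> `|f v - f w| < e).
Proof.
split => [cf e e0|H].
  have := cf _ (nbhsx_ballx (f v) e e0).
  move=> /nbhs_ballP[r r0 rf]; exists r => // w vw.
  by have := rf w; rewrite -!ball_normE; exact.
move=> A /nbhs_ballP[e e0 eA]; have [r r0 rf] := H e e0.
apply/nbhs_ballP; exists r => // w; rewrite -ball_normE => /= vw.
by apply: eA; rewrite -ball_normE; exact: rf.
Qed.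

Lemma cV_compact n (A : set 'cV[R]_n) : bounded_set A -> closed A -> compact A.
Proof.
move=> [M [Mreal bA]] clA.
have trc : forall p q, continuous (fun v : 'M[R]_(p, q) => v^T).
  move=> p q v; apply/mx_continuousP => e e0.
  by exists e => // w vw; rewrite (_ : _ - _ = (v - w)^T) ?norm_trmx// linearB.
have -> : A = trmx @` [set v : 'rV[R]_n | A v^T].
  apply/seteqP; split => [v Av|_ [v Av <-]//].
  by exists v^T => //=; rewrite trmxK.
apply: continuous_compact; first exact/continuous_subspaceT/trc.
apply: bounded_closed_compact.
  exists M; split => // x Mx v Av.
  by have := bA _ Mx _ Av; rewrite /= norm_trmx.
have := (@closed_comp _ _ (fun v : 'rV[R]_n => v^T) A) => /(_ _ clA); apply.
by move=> v _; exact: trc.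
Qed.

(** Rational vectors form the dense sequence. *)
Lemma cV_dense n : exists q : nat -> 'cV[R]_n,
  forall x e, 0 < e -> exists m, `|x - q m| < e.
Proof.
exists (fun m => map_mx ratr (odflt 0 (unpickle m : option 'cV[rat]_n))) => x e e0.
have /(_ _)/cid-/all_sig[y xy] i : exists y : rat, `|x i 0 - ratr y| < e / 2.
  have e20 : 0 < e / 2 by rewrite divr_gt0.
  have [|r [xr [y _ yr]]] := @dense_rat R (ball (x i 0) (e / 2)) _ (ball_open _ _).
    by exists (x i 0); exact: ballxx.
  by exists y; rewrite yr; exact: xr.
exists (pickle (\col_i y i)); rewrite pickleK/=.
rewrite (@le_lt_trans _ _ (e / 2))//; last by rewrite gtr_pMr// invf_lt1// ltr1n.
apply: norm_le_coord => [|i j]; first by rewrite ltW// divr_gt0.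
by rewrite !mxE ord1 ltW.
Qed.

(** The sequence is indexed by codes of pairs (m, l): its term is a point of
    S at distance less than 1/(l+1) from the m-th rational vector whenever there
    is one, and a fixed point of S otherwise. *)
Lemma cV_dense_in n (S : set 'cV[R]_n) : S !=set0 -> exists q : nat -> 'cV[R]_n,
  (forall m, S (q m)) /\
  forall x e, S x -> 0 < e -> exists m, `|x - q m| < e.
Proof.
move=> [s0 Ss0]; have [q qd] := cV_dense n.
have /(_ _)/cid-/all_sig[p pP] (ml : nat * nat) : exists y, S y /\
    ((exists y, S y /\ `|y - q ml.1| < ml.2.+1%:R^-1) ->
     `|y - q ml.1| < ml.2.+1%:R^-1).
  have [[y [Sy yq]]|ney] := pselect (exists y, S y /\ `|y - q ml.1| < ml.2.+1%:R^-1).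
    by exists y.
  by exists s0.
exists (fun m => p (odflt (0%N, 0%N) (unpickle m))); split=> [m|x e Sx e0].
  by have [] := pP (odflt (0%N, 0%N) (unpickle m)).
have [l le] : exists l, l.+1%:R^-1 < e / 2.
  have [l le] := ltr_add_invr (divr_gt0 e0 (@ltr0Sn R 1)).
  by exists l; rewrite add0r in le.
have l0 : 0 < l.+1%:R^-1 :> R by rewrite invr_gt0.
have [m xqm] := qd x _ l0.
exists (pickle (m, l)); rewrite pickleK/=.
have [_ /(_ (ex_intro _ x (conj Sx xqm)))/= pq] := pP (m, l).
rewrite -[x](subrK (q m)) -addrA (le_lt_trans (ler_normD _ _))//.
by rewrite [ltRHS]splitr ltrD// ?(lt_trans xqm)// distrC (lt_trans pq).
Qed.

Lemma cball_compact n (x : 'cV[R]_n) r : 0 < r -> compact [set y | `|x - y| <= r].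
Proof.
move=> r0; have := closed_ballE x r0; rewrite /closed_ball_ => <-.
apply: cV_compact; last exact: closed_ball_closed.
exists (`|x| + r); split; first exact: num_real.
move=> s xs y; rewrite closed_ballE// => /= xy; apply: ltW; apply: le_lt_trans xs.
by rewrite -[y](subrK x) addrC (le_trans (ler_normD _ _))// lerD2l distrC.
Qed.

End MatrixNorm.

(** * Convex functions and convex hulls *)

Section Convex.
Context {R : realType}.

Definition convex_fun n (g : 'cV[R]_n -> R) := forall x y t, 0 <= t <= 1 ->
  g (t *: x + (1 - t) *: y) <= t * g x + (1 - t) * g y.

Lemma strictly_convexW n (g : 'cV[R]_n -> R) : strictly_convex g -> convex_fun g.
Proof.
move=> scg x y t /andP[t0 t1].
have [->|xy] := eqVneq x y.
  by rewrite -scalerDl -mulrDl addrC subrK scale1r mul1r.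
have [->|tn0] := eqVneq t 0; first by rewrite subr0 !scale0r !add0r !scale1r mul0r mul1r add0r.
have [->|tn1] := eqVneq t 1; first by rewrite subrr !scale0r !addr0 !scale1r mul0r mul1r addr0.
by rewrite ltW// scg// !lt_neqAle t0 t1 tn1 eq_sym tn0.
Qed.

Lemma jensen_average n (g : 'cV[R]_n -> R) m (x : 'I_m.+1 -> 'cV[R]_n) : convex_fun g ->
  g (m.+1%:R^-1 *: \sum_i x i) <= m.+1%:R^-1 * \sum_i g (x i).
Proof.
move=> cg; elim: m x => [|m IH] x; first by rewrite !big_ord1 invr1 scale1r mul1r.
have m1 : m.+1%:R != 0 :> R by rewrite pnatr_eq0.
have m2 : m.+2%:R != 0 :> R by rewrite pnatr_eq0.
have m21 : m.+2%:R = 1 + m.+1%:R :> R by rewrite -natr1 addrC.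
pose t : R := m.+1%:R / m.+2%:R.
have t1 : 1 - t = m.+2%:R^-1.
  by apply: (mulIf m2); rewrite mulrBl mul1r divfK // mulVf // m21 addrK.
have tm (a : R) : m.+2%:R^-1 * a = t * (m.+1%:R^-1 * a).
  by rewrite mulrA; congr (_ * _); rewrite /t mulrAC divff // mul1r.
have -> : m.+2%:R^-1 *: \sum_i x i =
    t *: (m.+1%:R^-1 *: \sum_(i < m.+1) x (widen_ord (leqnSn _) i)) +
    (1 - t) *: x ord_max.
  rewrite big_ord_recr/= scalerDr t1; congr (_ + _).
  by rewrite scalerA; congr (_ *: _); rewrite -[LHS]mulr1 tm mulr1.
have t01 : 0 <= t <= 1.
  rewrite divr_ge0//= ler_pdivrMr// mul1r ler_nat//.
rewrite (le_trans (cg _ _ _ t01))//.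
rewrite [in leRHS]big_ord_recr/= [leRHS]mulrDr -t1 lerD2r t1 tm.
by rewrite ler_wpM2l//; case/andP: t01.
Qed.

(** Around x, the point x + v is the average of the n points
    x + n v_i e_i; each of them lies on a segment from x to x + e_i or x - e_i,
    where g exceeds g x by at most C times the length. This bounds g from above
    near x, and convexity at x, the midpoint of x + v and x - v, turns the upper
    bound into a lower one. *)
Lemma convex_continuous n (g : 'cV[R]_n -> R) : convex_fun g -> continuous g.
Proof.
move=> cg x; apply/mx_continuousP => e e0.
case: n => [|n'] in g cg x *.
  by exists 1 => // w _; rewrite (flatmx0 x) (flatmx0 w) subrr normr0.
pose E (i : 'I_n'.+1) : 'cV[R]_n'.+1 := delta_mx i 0.
pose C := \sum_i (`|g (x + E i) - g x| + `|g (x - E i) - g x|).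
have C0 : 0 <= C by apply: sumr_ge0 => i _; rewrite addr_ge0.
have Cge i : `|g (x + E i) - g x| + `|g (x - E i) - g x| <= C.
  by rewrite /C (bigD1 i)//= lerDl sumr_ge0// => l _; rewrite addr_ge0.
have line i s : `|s| <= 1 -> g (x + s *: E i) <= g x + `|s| * C.
  move=> s1; have [s0|s0] := leP 0 s.
    rewrite ger0_norm// in s1 *.
    have -> : x + s *: E i = s *: (x + E i) + (1 - s) *: x.
      by apply/colP => l; rewrite !mxE; ring.
    rewrite (le_trans (cg _ _ _ _)) ?s0//.
    have := ler_norm (g (x + E i) - g x); have := Cge i.
    have := normr_ge0 (g (x - E i) - g x); nra.
  rewrite ltr0_norm// in s1 *.
  have -> : x + s *: E i = (- s) *: (x - E i) + (1 - - s) *: x.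
    by apply/colP => l; rewrite !mxE; ring.
  rewrite (le_trans (cg _ _ _ _)) ?s1 ?oppr_ge0 ?(ltW s0)//.
  have := ler_norm (g (x - E i) - g x); have := Cge i.
  have := normr_ge0 (g (x + E i) - g x); nra.
have up v : n'.+1%:R * `|v| <= 1 -> g (x + v) <= g x + n'.+1%:R * `|v| * C.
  move=> v1.
  have -> : x + v = n'.+1%:R^-1 *: \sum_i (x + (n'.+1%:R * v i 0) *: E i).
    rewrite big_split/= scalerDr; congr (_ + _).
      by rewrite sumr_const card_ord -[x *+ _]scaler_nat scalerA mulVf ?scale1r ?pnatr_eq0.
    rewrite scaler_sumr; apply/colP => i; rewrite summxE (bigD1 i)//= big1 ?addr0.
      by rewrite !mxE !eqxx mulr1 mulrA mulVf ?mul1r// pnatr_eq0.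
    by move=> l li; rewrite !mxE eq_sym (negbTE li) !mulr0.
  rewrite (le_trans (jensen_average _ cg))//.
  rewrite mulrC ler_pdivrMr// (@le_trans _ _ (\sum_(i < n'.+1) (g x + n'.+1%:R * `|v| * C)))//.
    apply: ler_sum => i _.
    have vi : `|n'.+1%:R * v i 0| <= n'.+1%:R * `|v|.
      by rewrite normrM ger0_norm// ler_wpM2l// coord_le_norm.
    rewrite (le_trans (line _ _ _)) ?(le_trans vi)//.
    by rewrite lerD2l ler_wpM2r.
  by rewrite sumr_const card_ord mulr_natr.
have N0 : 0 < n'.+1%:R :> R by [].
pose r := Num.min (n'.+1%:R^-1) (e / (n'.+1%:R * C + 1)).
have NC : 0 < n'.+1%:R * C + 1 by rewrite ltr_wpDl// mulr_ge0.
exists r; first by rewrite lt_min invr_gt0 N0 divr_gt0.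
move=> w; rewrite lt_min distrC => /andP[w1 w2].
pose v := w - x; have xv : w = x + v by rewrite /v addrC subrK.
have v1 : n'.+1%:R * `|v| <= 1 by rewrite mulrC -ler_pdivlMr// mul1r ltW.
have ve : n'.+1%:R * `|v| * C < e.
  move: w2; rewrite ltr_pdivlMr// -/v => w2.
  by rewrite (le_lt_trans _ w2)// mulrDr mulr1 mulrAC mulrC lerDl.
have up1 := up v v1.
have up2 : g (x - v) <= g x + n'.+1%:R * `|v| * C.
  by have := up (- v); rewrite normrN; exact.
have mid : g x <= 2^-1 * g (x + v) + (1 - 2^-1) * g (x - v).
  have := cg (x + v) (x - v) 2^-1.
  rewrite (_ : _ *: _ + _ *: _ = x); last first.
    by apply/colP => i; rewrite !mxE; lra.
  apply; rewrite invr_ge0 ler0n/= invf_le1// ler1n//.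
rewrite xv ltr_norml; move: up1 up2 ve mid.
set gx := g x; set B := _ * C; move=> up1 up2 ve mid.
by apply/andP; split; lra.
Qed.

Lemma strictly_convex_continuous n (g : 'cV[R]_n -> R) : strictly_convex g -> continuous g.
Proof. by move=> /strictly_convexW; exact: convex_continuous. Qed.

Lemma affine_continuous n t (c : 'cV[R]_n) :
  continuous (fun y : 'cV[R]_n => t *: y + c).
Proof.
move=> v; apply/mx_continuousP => e e0.
have t0 : 0 < `|t| + 1 by rewrite ltr_wpDl.
exists (e / (`|t| + 1)) => [|w]; first by rewrite divr_gt0.
rewrite ltr_pdivlMr// => vw.
have -> : t *: v + c - (t *: w + c) = t *: (v - w).
  by rewrite opprD addrACA subrr addr0 scalerBr.
rewrite normrZ (le_lt_trans _ vw)// mulrC ler_wpM2l// lerDl//.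
Qed.

Lemma closure_lt n (S : set 'cV[R]_n) (h : 'cV[R]_n -> R) y c :
  closure S y -> {for y, continuous h} ->
  h y < c -> exists2 y', S y' & h y' < c.
Proof.
move=> Sy /mx_continuousP ch hc.
have [|r r0 rh] := ch (c - h y); first by rewrite subr_gt0.
have [y' [Sy' yy']] := Sy _ (nbhsx_ballx y r r0).
exists y' => //; move: yy'; rewrite -ball_normE => /rh.
rewrite ltr_norml => /andP[+ _]; lra.
Qed.

(** If another point y of the closure reached the minimum, the midpoint of y
    and y0 would do strictly better, and so would the midpoint of y0 and a point
    of S close to y. Passing to the closure is what gives compactness, since S
    need not be closed. *)
Lemma strictly_convex_argmin_closure n (S : set 'cV[R]_n) (p : 'cV[R]_n -> R) y0 :
  (forall x y, S x -> S y -> S (2^-1 *: x + (1 - 2^-1) *: y)) ->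
  strictly_convex p -> S y0 -> (forall y, S y -> p y0 <= p y) ->
  forall y, closure S y -> p y0 <= p y /\ (p y <= p y0 -> y = y0).
Proof.
move=> cS scp Sy0 pmin y Sy; have cp := strictly_convex_continuous scp.
split=> [|pyy0].
  rewrite leNgt; apply/negP => /(closure_lt Sy (cp y))[y' /pmin].
  by move=> /le_lt_trans/[apply]; rewrite ltxx.
apply/eqP/negPn/negP => yy0.
have half : 0 < (2^-1 : R) < 1 by rewrite invr_gt0 ltr0n invf_lt1// ltr1n.
have := scp _ _ _ yy0 half => /lt_le_trans -/(_ (p y0)) H.
have {}H : p (2^-1 *: y + (1 - 2^-1) *: y0) < p y0 by apply: H; lra.
have ch : {for y, continuous (fun y : 'cV[R]_n => p (2^-1 *: y + (1 - 2^-1) *: y0))}.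
  apply: (@continuous_comp _ _ _ (fun y : 'cV[R]_n => 2^-1 *: y + (1 - 2^-1) *: y0) p).
    exact: affine_continuous.
  exact: cp.
have [y' Sy' ] := closure_lt Sy ch H.
by rewrite ltNge pmin//; exact: cS.
Qed.

Lemma translate_continuous n (g : 'cV[R]_n -> R) (c : 'cV[R]_n) :
  continuous g -> continuous (fun y => g (c + y)).
Proof.
move=> cg y; apply: (@continuous_comp _ _ _ (fun y : 'cV[R]_n => c + y) g); last exact: cg.
have -> : (fun y : 'cV[R]_n => c + y) = (fun y => 1 *: y + c).
  by apply/funext => x; rewrite scale1r addrC.
exact: affine_continuous.
Qed.

Lemma strictly_convex_translate n (g : 'cV[R]_n -> R) (c : 'cV[R]_n) :
  strictly_convex g -> strictly_convex (fun y => g (c + y)).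
Proof.
move=> sg x y t xy t01.
have -> : c + (t *: x + (1 - t) *: y) = t *: (c + x) + (1 - t) *: (c + y).
  by apply/colP => i; rewrite !mxE; ring.
by apply: sg => //; apply: contra xy => /eqP/addrI/eqP.
Qed.

Lemma conv_hull_midpoint n (A : set 'cV[R]_n) x y :
  conv_hull A x -> conv_hull A y -> conv_hull A (2^-1 *: x + (1 - 2^-1) *: y).
Proof.
move=> Ax Ay C [cC AC].
have h01 : 0 <= (2^-1 : R) <= 1 by rewrite invr_ge0 ler0n invf_le1// ler1n.
have /set_mem := cC x y (Itv01 (andP h01).1 (andP h01).2) (mem_set (Ax C (conj cC AC)))
  (mem_set (Ay C (conj cC AC))).
by [].
Qed.

Lemma conv_hull_bounded n (A : set 'cV[R]_n) b : (forall x, A x -> `|x| <= b) ->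
  forall x, conv_hull A x -> `|x| <= b.
Proof.
move=> Ab x /(_ [set y | `|y| <= b]); apply; split => //= u v t.
move=> /set_mem/= ub /set_mem/= vb; apply/mem_set => /=.
have t0 : 0 <= t%:num by [].
have t1 : 0 <= 1 - t%:num by rewrite subr_ge0.
rewrite (le_trans (ler_normD _ _))// !normrZ !ger0_norm//.
rewrite (@le_trans _ _ (t%:num * b + (1 - t%:num) * b))//.
  by rewrite lerD// ler_wpM2l.
by rewrite -mulrDl addrC subrK mul1r.
Qed.

Lemma conv_hull_compact n (A : set 'cV[R]_n) b : 0 < b ->
  (forall x, A x -> `|x| <= b) -> compact (closure (conv_hull A)).
Proof.
move=> b0 Ab; apply: (@subclosed_compact _ _ [set y : 'cV[R]_n | `|0 - y| <= b]).
- exact: closed_closure.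
- exact: cball_compact.
have := closed_ballE (0 : 'cV[R]_n) b0; rewrite /closed_ball_ => E.
rewrite -E [X in _ `<=` X](closure_id _).1; last exact: closed_ball_closed.
apply: closure_subset; rewrite E => x /(conv_hull_bounded Ab) xb.
by rewrite /= sub0r normrN.
Qed.

End Convex.

(** * Functions continuous in a vector and measurable in a sample *)

Section Caratheodory.
Context {R : realType} {d : measure_display} {X : measurableType d} {k : nat}.
Implicit Type S : set 'cV[R]_k.

Lemma measurable_fun_ge (h : X -> R) :
  (forall c, measurable [set w | c <= h w]) -> measurable_fun setT h.
Proof.
move=> H; apply: (measurability (@RGenCInfty.G R)) => [|/= _ [_] [r] -> <-].
  exact: RGenCInfty.measurableE.
rewrite setTI (_ : _ @^-1` _ = [set w | r <= h w])//.
by apply/seteqP; split => w /=; rewrite in_itv/= andbT.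
Qed.

Lemma measurable_ge_fun (h g : X -> R) : measurable_fun setT h ->
  measurable_fun setT g -> measurable [set w | h w <= g w].
Proof.
move=> mh mg; rewrite -[X in measurable X]setTI.
have := measurable_fun_ler mh mg => /(_ measurableT [set true]); exact.
Qed.

Definition caratheodory (g : X -> 'cV[R]_k -> R) :=
  (forall y, measurable_fun setT (g^~ y)) /\
  (forall w, continuous (g w)).

(** The quantifier over the uncountable set S becomes countable: by
    compactness, g w reaches a nonnegative value on S iff its values on a dense
    sequence come arbitrarily close to being nonnegative. *)
Lemma measurable_exists_ge0 S (g : X -> 'cV[R]_k -> R) :
  compact S -> caratheodory g ->
  measurable [set w | exists2 y, S y & 0 <= g w y].
Proof.
move=> cS [mg cg].
have [->|/set0P S0] := eqVneq S set0.
  by rewrite (_ : mkset _ = set0)//; apply/seteqP; split => // w [].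
have [q [Sq qd]] := cV_dense_in S0.
rewrite (_ : mkset _ =
    \bigcap_l \bigcup_m [set w | - l.+1%:R^-1 <= g w (q m)]); last first.
  apply/seteqP; split => [w [y Sy gy] l _|w gw].
    have l0 : 0 < l.+1%:R^-1 :> R by rewrite invr_gt0.
    have /mx_continuousP/(_ _ l0)[e e0 eg] := cg w y.
    have [m ym] := qd y e Sy e0; exists m => //=.
    have := eg (q m) ym; rewrite ltr_norml => /andP[_]; move: gy.
    by set il := _^-1; set u := g w y; lra.
  (* The maximum of g w over S is the limit point that compactness provides. *)
  have [c /[1!inE] Sc cmax] := @compact_EVT_max _ R (g w) S S0 cS
    (continuous_subspaceT (cg w)).
  exists c => //; rewrite leNgt; apply/negP => gc.
  have [l gcl] := ltr_add_invr gc.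
  have [m _/= gm] := gw l I.
  have := cmax (q m); rewrite inE => /(_ (Sq m)).
  move: gcl gm; by set il := _^-1; lra.
apply: bigcapT_measurable => l; apply: bigcupT_measurable => m.
by apply: measurable_ge_fun; [exact: measurable_cst|exact: mg].
Qed.

Lemma caratheodory_min g h : caratheodory g -> caratheodory h ->
  caratheodory (fun w y => Num.min (g w y) (h w y)).
Proof.
move=> [mg cg] [mh ch]; split => [y|w y]; first exact: measurable_minr.
apply: (@continuous_min _ _ (g w) (h w) y); [exact: cg|exact: ch].
Qed.

Lemma caratheodoryB g h : caratheodory g -> caratheodory h ->
  caratheodory (fun w y => g w y - h w y).
Proof.
move=> [mg cg] [mh ch]; split => [y|w y]; first exact: measurable_funB.
apply: (@continuousB _ _ _ (g w) (h w) y); [exact: cg|exact: ch].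
Qed.

Lemma caratheodory_fst (h : X -> R) : measurable_fun setT h ->
  caratheodory (fun w _ => h w).
Proof. by move=> mh; split => // w y; exact: cst_continuous. Qed.

Lemma caratheodory_sum j (g : 'I_j -> X -> 'cV[R]_k -> R) :
  (forall i, caratheodory (g i)) ->
  caratheodory (fun w y => \sum_(i < j) g i w y).
Proof.
move=> cg; split => [y|w].
  by apply: measurable_sum => i; have [] := cg i.
apply: continuous_big => [|i _]; last by have [] := cg i.
by move=> xy; exact: add_continuous.
Qed.

(** The maximum of g w over the random compact set cut out of S by the
    constraints h i w >= 0 is at least c iff one point of S satisfies the
    constraints and g >= c; the sum of the negative parts of the h i packs all
    the constraints into a single inequality. *)
Lemma measurable_max_on S j (h : 'I_j -> X -> 'cV[R]_k -> R) g (m : X -> R) :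
  compact S -> (forall i, caratheodory (h i)) -> caratheodory g ->
  (forall w, exists2 y, S y /\ (forall i, 0 <= h i w y) & g w y = m w) ->
  (forall w y, S y -> (forall i, 0 <= h i w y) -> g w y <= m w) ->
  measurable_fun setT m.
Proof.
move=> cS ch cg em mub; apply: measurable_fun_ge => c.
pose H w y := Num.min (\sum_(i < j) Num.min (h i w y) 0) (g w y - c).
have cH : caratheodory H.
  apply: caratheodory_min; last by apply: caratheodoryB => //; exact: caratheodory_fst.
  by apply: caratheodory_sum => i; apply: caratheodory_min => //; exact: caratheodory_fst.
rewrite (_ : mkset _ = [set w | exists2 y, S y & 0 <= H w y]).
  exact: measurable_exists_ge0.
have Hge w y : 0 <= H w y <-> (forall i, 0 <= h i w y) /\ c <= g w y.
  rewrite /H le_min subr_ge0; split => [/andP[s0 ->]|[hi ->]]; last first.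
    by rewrite andbT sumr_ge0// => i _; rewrite le_min hi lexx.
  split => // i; rewrite leNgt; apply/negP => hi0.
  have : \sum_(i < j) Num.min (h i w y) 0 < 0.
    rewrite (bigD1 i)//= ltr_wnDr//; last by rewrite gt_min hi0.
    by apply: sumr_le0 => l _; rewrite ge_min lexx orbT.
  by rewrite ltNge s0.
apply/seteqP; split => [w /= cm|w /= [y Sy /Hge[hi cg']]].
  by have [y [Sy hi] gm] := em w; exists y => //; apply/Hge; rewrite gm.
exact: le_trans (mub w y Sy hi).
Qed.

(** A unique minimiser is a measurable function of the parameter: g w (ymin w)
    is at least c iff some point y of S has both g w y >= c and p w y no larger
    than the minimal value, and that minimal value is itself measurable. *)
Lemma measurable_argmin S p g (ymin : X -> 'cV[R]_k) :
  compact S -> caratheodory p -> caratheodory g ->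
  (forall w, S (ymin w)) ->
  (forall w y, S y -> p w (ymin w) <= p w y) ->
  (forall w y, S y -> p w y <= p w (ymin w) -> y = ymin w) ->
  measurable_fun setT (fun w => g w (ymin w)).
Proof.
move=> cS cp cg Symin pmin umin.
have noh (i : 'I_0) : caratheodory (fun (_ : X) (_ : 'cV[R]_k) => 0) by case: i.
have mv : measurable_fun setT (fun w => - p w (ymin w)).
  have cNp : caratheodory (fun w y => 0 - p w y).
    by apply: caratheodoryB => //; exact: caratheodory_fst.
  apply: (measurable_max_on cS noh cNp) => [w|w y Sy _].
    by exists (ymin w); [split => // -[]|rewrite sub0r].
  by rewrite sub0r lerN2 pmin.
apply: measurable_fun_ge => c.
pose H w y := Num.min (g w y - c) (- p w y - (- p w (ymin w))).
have cH : caratheodory H.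
  apply: caratheodory_min.
    by apply: caratheodoryB => //; exact: caratheodory_fst.
  apply: caratheodoryB; last exact: caratheodory_fst.
  rewrite (_ : (fun _ _ => _) = (fun w y => 0 - p w y)).
    by apply: caratheodoryB => //; exact: caratheodory_fst.
  by apply/funext => w; apply/funext => y; rewrite sub0r.
rewrite (_ : mkset _ = [set w | exists2 y, S y & 0 <= H w y]).
  exact: measurable_exists_ge0.
apply/seteqP; split => w /=; rewrite /H.
  by move=> cgw; exists (ymin w) => //; rewrite le_min subr_ge0 cgw subrr lexx.
move=> [y Sy]; rewrite le_min !subr_ge0 lerN2 => /andP[cgy pyv].
by rewrite -(umin w y Sy pyv).
Qed.

End Caratheodory.

(** * Quadratic forms and singular values *)

Section QuadraticForms.
Context {R : realType}.

Definition bilin m n (M : 'M[R]_(m, n)) (x : 'cV[R]_m) (y : 'cV[R]_n) : R :=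
  (x^T *m M *m y) 0 0.

Definition dotv n (x y : 'cV[R]_n) : R := (x^T *m y) 0 0.

Lemma bilinDl m n (M : 'M[R]_(m, n)) x x' y :
  bilin M (x + x') y = bilin M x y + bilin M x' y.
Proof. by rewrite /bilin linearD/= !mulmxDl mxE. Qed.

Lemma bilinDr m n (M : 'M[R]_(m, n)) x y y' :
  bilin M x (y + y') = bilin M x y + bilin M x y'.
Proof. by rewrite /bilin mulmxDr mxE. Qed.

Lemma bilinZl m n (M : 'M[R]_(m, n)) a x y : bilin M (a *: x) y = a * bilin M x y.
Proof. by rewrite /bilin linearZ/= -!scalemxAl mxE. Qed.

Lemma bilinZr m n (M : 'M[R]_(m, n)) a x y : bilin M x (a *: y) = a * bilin M x y.
Proof. by rewrite /bilin -!scalemxAr mxE. Qed.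

Lemma bilin_sym n (M : 'M[R]_n) x y : M^T = M -> bilin M x y = bilin M y x.
Proof.
by move=> sM; rewrite /bilin -[in LHS](trmxK (_ *m y)) mxE !trmx_mul trmxK sM mulmxA.
Qed.

Lemma dotvE n (x y : 'cV[R]_n) : dotv x y = \sum_i x i 0 * y i 0.
Proof. by rewrite /dotv mxE; apply: eq_bigr => i _; rewrite mxE. Qed.

Lemma dotvDr n (x y y' : 'cV[R]_n) : dotv x (y + y') = dotv x y + dotv x y'.
Proof. by rewrite /dotv mulmxDr mxE. Qed.

Lemma dotvBr n (x y y' : 'cV[R]_n) : dotv x (y - y') = dotv x y - dotv x y'.
Proof. by rewrite /dotv mulmxBr !mxE. Qed.

Lemma dotvZr n a (x y : 'cV[R]_n) : dotv x (a *: y) = a * dotv x y.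
Proof. by rewrite /dotv -scalemxAr mxE. Qed.

Lemma dotvC n (x y : 'cV[R]_n) : dotv x y = dotv y x.
Proof. by rewrite !dotvE; apply: eq_bigr => i _; rewrite mulrC. Qed.

Lemma dotv_ge_coord n (x : 'cV[R]_n) i : x i 0 ^+ 2 <= dotv x x.
Proof.
rewrite dotvE (bigD1 i)//= -expr2 lerDl sumr_ge0// => l _.
by rewrite -expr2 sqr_ge0.
Qed.

Lemma dotv_ge0 n (x : 'cV[R]_n) : 0 <= dotv x x.
Proof. by rewrite dotvE sumr_ge0// => i _; rewrite -expr2 sqr_ge0. Qed.

Lemma dotv_eq0 n (x : 'cV[R]_n) : dotv x x = 0 -> x = 0.
Proof.
move=> x0; apply/colP => i; rewrite mxE; apply/eqP; rewrite -sqrf_eq0.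
by rewrite eq_le sqr_ge0 andbT -x0 dotv_ge_coord.
Qed.

Lemma dotv_norm n (x y : 'cV[R]_n) U : (forall i, `|x i 0| <= U) ->
  `|dotv x y| <= n%:R * (U * `|y|).
Proof.
move=> xU; rewrite dotvE (le_trans (ler_norm_sum _ _ _))//.
rewrite (@le_trans _ _ (\sum_(i < n) (U * `|y|)))//.
  by apply: ler_sum => i _; rewrite normrM ler_pM// coord_le_norm.
by rewrite sumr_const card_ord mulr_natl.
Qed.

Lemma dotv_continuous n (x : 'cV[R]_n) : continuous (dotv x).
Proof.
rewrite (_ : dotv x = fun y => \sum_i x i 0 * y i 0); last first.
  by apply/funext => y; rewrite dotvE.
apply: continuous_big => [|i _ y]; first by move=> xy; exact: add_continuous.
apply: (@continuousM R 'cV[R]_n (fun=> x i 0) (fun y => y i 0)).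
  exact: cst_continuous.
exact: (@coord_continuous R n 1 i 0 y).
Qed.

Lemma bilinE n (M : 'M[R]_n) x y : bilin M x y = \sum_i \sum_j x i 0 * M i j * y j 0.
Proof.
rewrite /bilin -mulmxA mxE; apply: eq_bigr => i _.
by rewrite !mxE mulr_sumr; apply: eq_bigr => j _; rewrite mulrA.
Qed.

Lemma continuous_bilin_comp n (X : topologicalType) (M : 'M[R]_n) (v : X -> 'cV[R]_n) :
  (forall i, continuous (fun x => v x i 0)) ->
  continuous (fun x => bilin M (v x) (v x)).
Proof.
move=> cv.
have -> : (fun w => bilin M (v w) (v w)) =
    (fun w => \sum_i \sum_j v w i 0 * M i j * v w j 0).
  by apply/funext => w; rewrite bilinE.
have sc : continuous (fun xy : R^o * R^o => xy.1 + xy.2).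
  by move=> xy; exact: add_continuous.
apply: continuous_big => [//|i _].
apply: continuous_big => [//|j _] y.
apply: (@continuousM R X (fun y => v y i 0 * M i j)); last exact: cv.
by apply: (@continuousM R X (fun y => v y i 0)); [exact: cv|exact: cst_continuous].
Qed.

Lemma bilin_continuous n (M : 'M[R]_n) : continuous (fun x => bilin M x x).
Proof. by apply: continuous_bilin_comp => i; exact: coord_continuous. Qed.

(** Cauchy-Schwarz for a degenerate form, by evaluating it at x - s P x with
    s = |P x|^2 / (B + 1), where B is its value at P x. *)
Lemma psd_kernel n (P : 'M[R]_n) x : P^T = P -> (forall y, 0 <= bilin P y y) ->
  bilin P x x = 0 -> P *m x = 0.
Proof.
move=> sP psdP x0; apply: dotv_eq0; set y := P *m x.
have yx : bilin P y x = dotv y y by rewrite /bilin -mulmxA.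
have B0 := psdP y; set B := bilin P y y in B0.
have := psdP (x + (- (dotv y y / (B + 1))) *: y).
rewrite !(bilinDl, bilinDr, bilinZl, bilinZr) x0 (bilin_sym x y sP) yx -/B.
have B1 : 0 < B + 1 by rewrite ltr_wpDl.
have := dotv_ge0 y; set D := dotv y y => D0.
set s := D / (B + 1); have Ds : D = s * (B + 1) by rewrite /s divfK// gt_eqF.
have s0 : 0 <= s by rewrite /s divr_ge0// ltW.
move=> H; suff : s = 0 by rewrite Ds => ->; rewrite mul0r.
rewrite Ds in H.
have {}H : 0 <= - (s ^+ 2 * (B + 2)).
  by rewrite (le_trans H)// le_eqVlt; apply/orP; left; apply/eqP; ring.
rewrite oppr_ge0 pmulr_lle0 ?ltr_wpDl// in H.
by apply/eqP; rewrite -sqrf_eq0 eq_le H sqr_ge0.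
Qed.

(** The quadratic form of M reaches its minimum l on the unit sphere at some
    x. Then M - l is positive semidefinite and its form vanishes at x, so that x
    is in its kernel: l is an eigenvalue. *)
Lemma rayleigh_min n (M : 'M[R]_n.+1) : M^T = M ->
  exists (x : 'cV[R]_n.+1) l,
    [/\ x != 0, M *m x = l *: x & forall y, l * dotv y y <= bilin M y y].
Proof.
move=> sM; pose S := [set x : 'cV[R]_n.+1 | dotv x x = 1].
have S0 : S !=set0.
  exists (delta_mx 0 0); rewrite /S/= dotvE (bigD1 0)//= big1 ?addr0.
    by rewrite !mxE eqxx mulr1.
  by move=> i i0; rewrite !mxE (negbTE i0) mulr0.
have cd : continuous (fun x : 'cV[R]_n.+1 => dotv x x).
  have -> : (fun x : 'cV[R]_n.+1 => dotv x x) = (fun x => bilin 1%:M x x).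
    by apply/funext => x; rewrite /bilin mulmx1.
  exact: bilin_continuous.
have cS : compact S.
  apply: cV_compact.
    exists 1; split => // r r1 x /= Sx; rewrite (le_trans _ (ltW r1))//.
    apply: norm_le_coord => // i j; rewrite ord1.
    by rewrite -ler_sqr ?nnegrE// real_normK ?num_real// expr1n -Sx dotv_ge_coord.
  rewrite /S (_ : mkset _ = (fun x => dotv x x) @^-1` [set 1])//.
  by apply: closed_comp => [x _|]; [exact: cd|exact: closed_eq].
have [x /[1!inE] Sx xmin] := compact_EVT_min S0 cS
  (continuous_subspaceT (@bilin_continuous _ M)).
pose l := bilin M x x.
have lmin y : l * dotv y y <= bilin M y y.
  have [->|y0] := eqVneq y 0.
    by rewrite /dotv /bilin !mulmx0 mxE mulr0.
  have dy : 0 < dotv y y.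
    by rewrite lt_neqAle dotv_ge0 andbT; apply: contra y0 => /eqP/esym/dotv_eq0/eqP.
  have sy : Num.sqrt (dotv y y) ^+ 2 = dotv y y by rewrite sqr_sqrtr// ltW.
  have sy0 : Num.sqrt (dotv y y) != 0 by rewrite gt_eqF// sqrtr_gt0.
  have := xmin ((Num.sqrt (dotv y y))^-1 *: y); rewrite inE /S/=.
  rewrite dotvZr dotvC dotvZr mulrA -expr2 exprVn sy mulVf ?gt_eqF// => /(_ erefl).
  by rewrite bilinZl bilinZr mulrA -expr2 exprVn sy -/l mulrC ler_pdivlMr.
exists x, l; split=> //.
  apply: contraTneq (ltr01 : 0 < 1 :> R) => x0.
  by rewrite -Sx x0 /dotv mulmx0 mxE ltxx.
apply/eqP; rewrite -subr_eq0 -mul_scalar_mx -mulmxBl.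
have PE y : bilin (M - l%:M) y y = bilin M y y - l * dotv y y.
  rewrite /bilin mulmxBr mulmxBl mul_mx_scalar -scalemxAl /dotv.
  by rewrite [LHS]mxE [X in _ + X]mxE [X in _ - X]mxE.
apply/eqP/psd_kernel => [|y|].
- by rewrite linearB/= sM tr_scalar_mx.
- by rewrite PE subr_ge0.
- by rewrite PE Sx mulr1 subrr.
Qed.

Lemma pd_coercive n (M : 'M[R]_n) : pd M ->
  exists2 c : R, 0 < c & forall v, c * dotv v v <= bilin M v v.
Proof.
case: n M => [|n] M [sM pM].
  by exists 1 => // v; rewrite (flatmx0 v) /dotv /bilin !mulmx0 mxE mulr0.
have [x [l [x0 Mx lmin]]] := rayleigh_min sM.
exists l => //; have := pM x x0; rewrite -mulmxA Mx -scalemxAr mxE.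
rewrite pmulr_lgt0// lt_neqAle dotv_ge0 andbT.
by apply: contra x0 => /eqP/esym/dotv_eq0/eqP.
Qed.

Lemma sigma_min_gram k T (M : 'M[R]_(k, T)) a : 0 < a -> (k <= T)%N ->
  a <= sigma_min M -> forall y, a ^+ 2 * dotv y y <= bilin (M *m M^T) y y.
Proof.
move=> a0 kT aM; case: k => [|k] in M kT aM *.
  by move=> y; rewrite (flatmx0 y) /dotv /bilin !mulmx0 mxE mulr0.
have sG : (M *m M^T)^T = M *m M^T by rewrite trmx_mul trmxK.
have [x [l [x0 Gx lmin]]] := rayleigh_min sG.
have al : a <= Num.sqrt l.
  rewrite (le_trans aM)//; apply: ge_inf.
    by exists 0 => _ [b _ <-]; exact: sqrtr_ge0.
  exists l => //=; rewrite kT; apply/eigenvalueP; exists x^T.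
    by rewrite -[X in _ *m X]sG -trmx_mul Gx linearZ.
  by apply: contra x0 => /eqP xT0; rewrite -(trmxK x) xT0 trmx0.
have l0 : 0 <= l.
  by rewrite leNgt; apply/negP => /ltW/ler0_sqrtr l0; move: al; rewrite l0 leNgt a0.
move=> y; rewrite (le_trans _ (lmin y))// ler_wpM2r ?dotv_ge0//.
by rewrite -(sqr_sqrtr l0) ler_sqr ?nnegrE ?sqrtr_ge0// ltW.
Qed.

(** The i-th column u of the pseudo-inverse M^T G^-1, with G = M M^T. With
    y = G^-1 e_i one gets |u|^2 = y_i = y^T G y >= a^2 y_i^2, hence
    |u|^2 <= 1/a^2. *)
Lemma bounded_right_inverse k T (M : 'M[R]_(k, T)) a : 0 < a -> row_free M ->
  a <= sigma_min M ->
  forall i, exists u : 'cV[R]_T, M *m u = delta_mx i 0 /\ forall m, `|u m 0| <= a^-1.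
Proof.
move=> a0 fM aM i.
have kT : (k <= T)%N by move: fM; rewrite /row_free => /eqP <-; exact: rank_leq_col.
have G2 := sigma_min_gram a0 kT aM; pose G := M *m M^T; rewrite -/G in G2.
have uG : G \in unitmx.
  rewrite -row_free_unit -kermx_eq0; apply/eqP/row_matrixP => l; rewrite row0.
  set v := row l _; have vG : v *m G = 0 by rewrite /v -row_mul mulmx_ker row0.
  apply: trmx_inj; rewrite trmx0; apply: dotv_eq0; apply/eqP; rewrite eq_le dotv_ge0 andbT.
  have := G2 v^T; rewrite /bilin trmxK vG mul0mx mxE.
  by rewrite pmulr_rle0// exprn_gt0.
pose y := invmx G *m (delta_mx i 0 : 'cV[R]_k); pose u := M^T *m y.
have Gy : G *m y = delta_mx i 0 by rewrite /y mulmxA mulmxV// mul1mx.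
have uu : dotv u u = y i 0.
  rewrite /dotv /u trmx_mul trmxK -mulmxA (mulmxA M) -/G Gy.
  by rewrite -colE !mxE.
exists u; split => [|m]; first by rewrite /u mulmxA.
have {}G2 := G2 y.
have GE : bilin G y y = y i 0.
  by rewrite /bilin -mulmxA Gy -colE !mxE.
have y2 := dotv_ge_coord y i.
have y0 : 0 <= y i 0 by rewrite -uu dotv_ge0.
have ya : y i 0 <= a^-1 ^+ 2.
  rewrite exprVn -div1r ler_pdivlMr ?exprn_gt0//.
  have [->|yn0] := eqVneq (y i 0) 0; first by rewrite mul0r.
  have yi0 : 0 < y i 0 by rewrite lt_neqAle eq_sym yn0.
  rewrite -(ler_pM2l yi0) mulr1 -{3}GE (le_trans _ G2)// mulrA -expr2 mulrC.
  by rewrite ler_wpM2l// exprn_ge0// ltW.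
have a10 : 0 <= a^-1 by rewrite invr_ge0 ltW.
rewrite -ler_sqr ?nnegrE// real_normK ?num_real//.
by rewrite (le_trans (dotv_ge_coord u m))// uu.
Qed.

Lemma continuous_Zform T (X : topologicalType) (Pi : 'M[R]_(1 + T)) (v : X -> 'cV[R]_T) :
  (forall i, continuous (fun x => v x i 0)) ->
  continuous (fun x => bilin Pi (col_mx 1%:M (v x)) (col_mx 1%:M (v x))).
Proof.
move=> cv; apply: continuous_bilin_comp => i.
have [l ->|l ->] := split_ordP i.
  under eq_fun do rewrite col_mxEu; exact: cst_continuous.
under eq_fun do rewrite col_mxEd; exact: cv.
Qed.

End QuadraticForms.

Section MeasurableForms.
Context {R : realType} {d : measure_display} {X : measurableType d}.

Lemma measurable_bilin n (M : 'M[R]_n) (v : X -> 'cV[R]_n) :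
  (forall i, measurable_fun setT (fun w => v w i 0)) ->
  measurable_fun setT (fun w => bilin M (v w) (v w)).
Proof.
move=> mv.
have -> : (fun w => bilin M (v w) (v w)) =
    (fun w => \sum_i \sum_j v w i 0 * M i j * v w j 0).
  by apply/funext => w; rewrite bilinE.
apply: measurable_sum => i; apply: measurable_sum => j.
apply: measurable_funM => //; apply: measurable_funM => //.
Qed.

Lemma measurable_Zform T (Pi : 'M[R]_(1 + T)) (v : X -> 'cV[R]_T) :
  (forall i, measurable_fun setT (fun w => v w i 0)) ->
  measurable_fun setT (fun w => bilin Pi (col_mx 1%:M (v w)) (col_mx 1%:M (v w))).
Proof.
move=> mv; apply: measurable_bilin => i.
have [l ->|l ->] := split_ordP i.
  under eq_fun do rewrite col_mxEu; exact: measurable_cst.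
under eq_fun do rewrite col_mxEd; exact: mv.
Qed.

End MeasurableForms.

(** * Ellipsoids *)

Section Ellipsoid.
Context {R : realType} {T : nat} (Pi : 'M[R]_(1 + T)).
Hypothesis Pi_neg : pd (- drsubmx Pi).
Let S := - drsubmx Pi.

Let q (v : 'cV[R]_T) : R := ((col_mx 1%:M v)^T *m Pi *m col_mx 1%:M v) 0 0.

Let lin : 'cV[R]_T := (ursubmx Pi)^T + dlsubmx Pi.

Let qE v : q v = ulsubmx Pi 0 0 + dotv lin v - bilin S v v.
Proof.
rewrite /q -{1}[Pi]submxK tr_col_mx mul_row_block mul_row_col trmx1 !mul1mx.
rewrite mulmx1 mulmxDl [LHS]mxE [X in X + _]mxE [X in _ + X]mxE.
have -> : bilin S v v = - (v^T *m drsubmx Pi *m v) 0 0.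
  by rewrite /bilin /S mulmxN mulNmx mxE.
have -> : dotv lin v = (ursubmx Pi *m v) 0 0 + (v^T *m dlsubmx Pi) 0 0.
  rewrite -/(dotv v _) [dotv v _]dotvC /dotv /lin linearD/= mulmxDl trmxK [LHS]mxE.
  by [].
by rewrite opprK addrA addrA [ulsubmx Pi 0 0 + _ + _]addrAC.
Qed.

Let qconv t x y : q (t *: x + (1 - t) *: y) =
  t * q x + (1 - t) * q y + t * (1 - t) * bilin S (x - y) (x - y).
Proof.
rewrite !qE !dotvDr !dotvZr -(scaleN1r y) !(bilinDl, bilinDr, bilinZl, bilinZr).
ring.
Qed.

Let Sge0 x : 0 <= bilin S x x.
Proof.
have [->|x0] := eqVneq x 0; first by rewrite /bilin mulmx0 mxE.
by apply: ltW; apply: Pi_neg.2.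
Qed.

Let q_continuous : continuous q.
Proof.
rewrite (_ : q = fun v => ulsubmx Pi 0 0 + dotv lin v - bilin S v v); last first.
  by apply/funext => v; rewrite qE.
move=> v.
apply: (@continuousB R R^o 'cV[R]_T (fun v => ulsubmx Pi 0 0 + dotv lin v)
  (fun v => bilin S v v)); last exact: bilin_continuous.
apply: (@continuousD R R^o 'cV[R]_T (fun=> _) (dotv lin)).
  exact: cst_continuous.
exact: dotv_continuous.
Qed.

Lemma Zset_nbhs v : 0 < q v ->
  exists2 r : R, 0 < r & forall w, `|v - w| <= r -> Zset Pi w.
Proof.
move=> qv; have := q_continuous (x := v).
move=> /mx_continuousP/(_ _ qv)[r r0 rq].
exists (r / 2) => [|w vw]; first by rewrite divr_gt0.
have /rq : `|v - w| < r by rewrite (le_lt_trans vw)// gtr_pMr// invf_lt1// ltr1n.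
by rewrite ltr_norml => /andP[_]; rewrite ltrBlDr -ltrBlDl subrr => /ltW.
Qed.

Lemma Zset_convex t x y : 0 <= t <= 1 -> Zset Pi x -> Zset Pi y ->
  Zset Pi (t *: x + (1 - t) *: y).
Proof.
move=> /andP[t0 t1] qx qy; rewrite /Zset/= -/(q _) qconv.
by rewrite !addr_ge0// !mulr_ge0// subr_ge0.
Qed.

Lemma Zset_interior x y : Zset Pi x -> Zset Pi y -> x != y ->
  let c := 2^-1 *: x + (1 - 2^-1) *: y in
  exists2 r : R, 0 < r & forall w, `|c - w| <= r -> Zset Pi w.
Proof.
move=> qx qy xy c; apply: Zset_nbhs.
rewrite /c qconv ltr_wpDl//.
  by rewrite addr_ge0// mulr_ge0//; lra.
rewrite mulr_gt0//; first by lra.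
by apply: Pi_neg.2; rewrite subr_eq0.
Qed.

(** With c > 0 a lower bound for the quadratic part, a point v of the set
    satisfies c |v|^2 <= K + L |v|, where K and L bound the constant and the
    linear part. *)
Lemma Zset_bounded : exists2 r : R, 0 < r & forall v, Zset Pi v -> `|v| <= r.
Proof.
have [c c0 cS] := pd_coercive Pi_neg.
pose L := T%:R * `|lin|; pose K := `|ulsubmx Pi 0 0|.
have L0 : 0 <= L by rewrite mulr_ge0.
have K0 : 0 <= K by exact: normr_ge0.
exists (1 + (K + L) / c) => [|v qv]; first by rewrite ltr_wpDr// divr_ge0 ?addr_ge0// ltW.
set N := `|v|; have N0 : 0 <= N by exact: normr_ge0.
have cN i : c * v i 0 ^+ 2 <= K + L * N.
  have : c * v i 0 ^+ 2 <= bilin S v v.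
    by rewrite (le_trans _ (cS v))// ler_wpM2l ?dotv_ge_coord// ltW.
  have : dotv lin v <= L * N.
    rewrite (le_trans (ler_norm _))// (le_trans (dotv_norm (U := `|lin|) _ _)) ?mulrA//.
    by move=> l; exact: coord_le_norm.
  have := ler_norm (ulsubmx Pi 0 0); rewrite -/K.
  by have : 0 <= q v := qv; rewrite qE; lra.
have NN : N ^+ 2 <= (K + L * N) / c.
  have KL : 0 <= (K + L * N) / c by rewrite divr_ge0 ?(ltW c0)// addr_ge0// mulr_ge0.
  rewrite -(sqr_sqrtr KL) ler_sqr ?nnegrE ?sqrtr_ge0//.
  apply: norm_le_coord => [|i j]; first exact: sqrtr_ge0.
  rewrite ord1 -ler_sqr ?nnegrE ?sqrtr_ge0// real_normK ?num_real// sqr_sqrtr//.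
  by rewrite ler_pdivlMr// mulrC.
rewrite leNgt; apply/negP => N1.
have KLc : 0 <= (K + L) / c by rewrite divr_ge0 ?(ltW c0)// addr_ge0.
have : (K + L * N) / c <= (K + L) / c * N.
  rewrite ler_pdivrMr// [leRHS]mulrAC divfK ?gt_eqF// mulrDl lerD2r ler_peMr//.
  by rewrite (le_trans _ (ltW N1))// lerDl.
move: KLc N1 NN; set B := (K + L) / c; move=> KLc N1 NN NB.
have : N * (1 + B) < N * N by rewrite ltr_pM2l// (lt_trans _ N1)// ltr_wpDr.
rewrite -expr2 => /lt_le_trans/(_ NN)/lt_le_trans/(_ NB).
by rewrite mulrDr mulr1 [B * N]mulrC gtrDr ltNge N0.
Qed.

(** Contract a box contained in Z towards a point ws of Z that nearly maximises
    dotv u. By convexity the contracted box stays in Z; if the ratio t is small,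
    it also stays in the cap where dotv u is within delta of its maximum. As t
    depends on u only through the bound U, so does the size of the box. *)
Lemma Zset_cap c r0 : 0 < r0 -> (forall w, `|c - w| <= r0 -> Zset Pi w) ->
  forall U delta, 0 <= U -> 0 < delta -> exists2 r, 0 < r &
  forall u : 'cV[R]_T, (forall m, `|u m 0| <= U) -> exists o, forall w, `|o - w| <= r ->
    Zset Pi w /\ forall v, Zset Pi v -> dotv u v <= dotv u w + delta.
Proof.
move=> r00 cZ U delta U0 delta0.
have [b b0 Zb] := Zset_bounded.
(* D bounds the variation of dotv u over the set. *)
pose D := T%:R * (U * (b + b)).
have D0 : 0 <= D by rewrite !mulr_ge0// addr_ge0// ltW.
pose t := Num.min 2^-1 (delta / 2 / (D + 1)).
have D1 : 0 < D + 1 by rewrite ltr_wpDl.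
have t0 : 0 < t by rewrite lt_min invr_gt0 ltr0n !divr_gt0.
have t1 : t <= 2^-1 by rewrite ge_min lexx.
have tD : t * D <= delta / 2.
  rewrite (@le_trans _ _ (t * (D + 1)))//; first by rewrite ler_wpM2l ?lerDl ?ltW.
  by rewrite -ler_pdivlMr// ge_min lexx orbT.
exists (t * r0); first by rewrite mulr_gt0.
move=> u uU; pose E := [set dotv u v | v in Zset Pi].
have supE : has_sup E.
  split.
    by exists (dotv u c), c => //; apply: cZ; rewrite subrr normr0 ltW.
  exists (T%:R * (U * b)) => _ [v Zv <-].
  rewrite (le_trans (ler_norm _))// (le_trans (dotv_norm _ uU))//.
  by rewrite ler_wpM2l// ler_wpM2l// Zb.
have d20 : 0 < delta / 2 by rewrite divr_gt0.
have [_ [ws Zws <-] wsup] := sup_adherent d20 supE.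
exists ((1 - t) *: ws + t *: c) => w ow.
pose w' := c + t^-1 *: (w - ((1 - t) *: ws + t *: c)).
have Zw' : Zset Pi w'.
  apply: cZ; rewrite /w' opprD addrA subrr add0r normrN normrZ distrC.
  by rewrite gtr0_norm ?invr_gt0// mulrC ler_pdivrMr// mulrC.
have wE : w = t *: w' + (1 - t) *: ws.
  rewrite /w' scalerDr scalerA divff ?gt_eqF// scale1r.
  by apply/colP => i; rewrite !mxE; ring.
split=> [|v Zv].
  by rewrite wE; apply: Zset_convex => //; rewrite ltW//=; lra.
have vs : dotv u v <= sup E by apply: ub_le_sup; [case: supE|exists v].
have : `|dotv u (ws - w')| <= D.
  rewrite (le_trans (dotv_norm _ uU))// ler_wpM2l// ler_wpM2l//.
  by rewrite (le_trans (ler_normB _ _))// lerD// Zb.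
rewrite ler_norml => /andP[_]; rewrite dotvBr => wD.
rewrite wE dotvDr !dotvZr; nra.
Qed.

End Ellipsoid.

(** * Lebesgue measure of boxes *)

Section Boxes.
Context {R : realType}.

(** A closed cube, that is a ball of the sup norm. The radius r = 0 gives a
    single point, which is used to see that points are negligible. *)
Definition box T (o : 'I_T -> R) (r : R) : set (Rtuple R T) :=
  [set w | forall i, `|o i - tnth w i| <= r].

Lemma boxE T (o : 'I_T -> R) r :
  box o r = \bigcap_(i in [set: 'I_T])
    ((fun w : Rtuple R T => tnth w i) @^-1` `[o i - r, o i + r]%classic).
Proof.
apply/seteqP; split => [w bw i _ /=|w bw i]; last first.
  by rewrite ler_distlC; have := bw i I; rewrite /= in_itv/=.
by rewrite in_itv/= -ler_distlC; exact: bw.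
Qed.

Lemma measurable_box T (o : 'I_T -> R) r : measurable (box o r).
Proof.
rewrite boxE; apply: fin_bigcap_measurable => // i _.
rewrite -[X in measurable X]setTI; apply: measurable_tnth => //.
Qed.

Lemma lebesgue_box T (o : 'I_T -> R) r : 0 <= r ->
  lebesgue_tuple R T (box o r) = ((r *+ 2) ^+ T)%:E.
Proof.
move=> r0; elim: T o => [|T IH] o.
  by rewrite /lebesgue_tuple/= diracE mem_set ?expr0// => -[].
have E : cons_pair (n := T) @^-1` box o r =
    `[o ord0 - r, o ord0 + r]%classic `*` box (fun i => o (lift ord0 i)) r.
  apply/seteqP; split => [[x t] /= H|[x t] /= [xo H]].
    split; first by have := H ord0; rewrite /= in_itv/= -ler_distlC.
    by move=> i; have := H (lift ord0 i); rewrite (tnth_nth x)/= (tnth_nth x).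
  move=> i; have [j ->|->] := unliftP ord0 i.
    by have := H j; rewrite [X in _ - X](tnth_nth x)/= (tnth_nth x).
  by rewrite ler_distlC; move: xo; rewrite in_itv.
rewrite /lebesgue_tuple/= /cons_measure /pushforward E.
rewrite product_measure1E//=; last exact: measurable_box.
rewrite [X in (_ * X)%E]IH lebesgue_measure_itv/= lte_fin.
rewrite -EFinB; have -> : o ord0 + r - (o ord0 - r) = r *+ 2 by rewrite mulr2n; ring.
case: ifPn => [_|]; first by rewrite exprS EFinM.
rewrite -leNgt => rr; have -> : r = 0 by lra.
by rewrite mul0rn mul0e exprS mul0r.
Qed.

End Boxes.

(** * Independence from the past *)

Section Filtration.
Context {R : realType} {T : nat} {d : measure_display}.
Context {Omega : measurableType d} (P : probability Omega R).
Variable W : nat -> {RV P >-> Rtuple R T}.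

(** These sets form a pi-system which generates the sigma-algebra of
    W 0, ..., W (j - 1). *)
Definition cylinder j : set (set Omega) :=
  [set E | exists2 A : nat -> set (Rtuple R T), (forall l, measurable (A l)) &
     E = \bigcap_(l in `I_j) (W l @^-1` A l)].

(** Omega equipped with the smaller sigma-algebra; being a type, it gives
    access to the theory of measurable functions for adapted quantities. *)
Definition past j : measurableType _ := g_sigma_algebraType (cylinder j).

Lemma measurable_W l A : measurable A -> measurable (W l @^-1` A).
Proof. by move=> mA; rewrite -[X in measurable X]setTI; exact: measurable_funP. Qed.

Lemma cylinder_measurable j : cylinder j `<=` measurable.
Proof.
by move=> _ [A mA ->]; apply: fin_bigcap_measurable => // l _; exact: measurable_W.
Qed.

Lemma past_measurable j (E : set (past j)) : measurable E -> d.-measurable E.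
Proof. by apply: smallest_sub; [exact: sigma_algebra_measurable|exact: cylinder_measurable]. Qed.

Lemma measurable_past_W j l : (l < j)%N ->
  measurable_fun setT (W l : past j -> Rtuple R T).
Proof.
move=> lj _ A mA; rewrite setTI; apply: sub_sigma_algebra.
exists (fun m => if m == l then A else setT) => [m|]; first by case: ifP.
apply/seteqP; split => [w Aw m /= mj|w /(_ l lj)/=]; last by rewrite eqxx.
by case: eqP => // ->.
Qed.

Lemma cylinder_setI j : setI_closed (cylinder j).
Proof.
move=> _ _ [A mA ->] [B mB ->]; exists (fun l => A l `&` B l).
  by move=> l; exact: measurableI.
by rewrite -bigcapI.
Qed.

Hypothesis indepW : mutually_independent W.

(** Both sides are finite measures in E, and they agree on the pi-system of
    cylinders by mutual independence. *)
Lemma past_independent j (E : set (past j)) B : measurable E -> measurable B ->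
  P (E `&` W j @^-1` B) = (P E * P (W j @^-1` B))%E.
Proof.
move=> mE mB; have mWB := measurable_W j mB.
have fWB : P (W j @^-1` B) \is a fin_num by exact: fin_num_measure.
pose b := NngNum (fine_ge0 (measure_ge0 P (W j @^-1` B))).
have scaleE A : mscale b P A = (P A * P (W j @^-1` B))%E.
  by rewrite -[in RHS](fineK fWB) muleC.
rewrite -scaleE -[LHS]/(mrestr P mWB E).
apply: (g_sigma_algebra_measure_unique (cylinder j)
  (@cylinder_measurable j) (fun=> setT) _ _ (mrestr P mWB) (mscale b P)
  (@cylinder_setI j) _ _ E mE).
- move=> _; exists (fun=> setT) => //; apply/seteqP; split => // w _ l _ //.
- by rewrite -subTset => w _; exists 0%N.
- move=> _ [A mA ->]; set G := \bigcap_(l in _) _.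
  suff : P (G `&` W j @^-1` B) = mscale b P G by [].
  rewrite scaleE {}/G.
  pose A' l := if l == j then B else A l.
  have mA' l : measurable (A' l) by rewrite /A'; case: ifP.
  have A'l l : (l < j)%N -> A' l = A l by rewrite /A'; case: eqP => // ->; rewrite ltnn.
  have A'j : A' j = B by rewrite /A' eqxx.
  have u1 : uniq (iota 0 j) by exact: iota_uniq.
  have u2 : uniq (j :: iota 0 j) by rewrite /= u1 mem_iota ltnn.
  have iE : \bigcap_(l in `I_j) (W l @^-1` A l) =
      \bigcap_(l in [set` iota 0 j]) (W l @^-1` A' l).
    apply/seteqP; split => w H l /=.
      by rewrite mem_iota add0n/= => lj; rewrite A'l//; exact: H.
    by move=> lj; rewrite -A'l//; apply: H; rewrite /= mem_iota.
  have jE : (\bigcap_(l in `I_j) (W l @^-1` A l)) `&` W j @^-1` B =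
      \bigcap_(l in [set` (j :: iota 0 j)]) (W l @^-1` A' l).
    rewrite iE; apply/seteqP; split => [w [H1 H2] l /=|w H].
      by rewrite inE => /predU1P[->|lj]; [rewrite /= A'j|exact: H1].
    split=> [l lj|]; first by apply: H; rewrite /= inE lj orbT.
    by have := H j; rewrite A'j; apply; rewrite /= mem_head.
  by rewrite jE iE indepW// indepW// big_cons A'j muleC.
- by move=> _; suff : (P (setT `&` W j @^-1` B) < +oo)%E by []; rewrite setTI ltey_eq fWB.
Qed.

(** The past chooses the target: on the piece C m it aims at B m. Whatever
    the choice, the next sample misses its target with probability at most 1 - p,
    independently of the past event E. *)
Lemma past_decay j (E : set (past j)) (C : nat -> set (past j)) B (p : R) :
  measurable E -> (forall m, measurable (C m)) -> trivIset setT C ->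
  (forall m, measurable (B m)) -> (forall m, p%:E <= P (W j @^-1` B m))%E -> p <= 1 ->
  (P (E `&` \bigcup_m (C m `&` W j @^-1` (~` B m))) <= (1 - p)%:E * P E)%E.
Proof.
move=> mE mC tC mB pB p1.
have mEC m : d.-measurable (E `&` C m).
  by apply: (@past_measurable j); exact: measurableI.
have mCB m : d.-measurable (E `&` C m `&` W j @^-1` (~` B m)).
  by apply: measurableI => //; apply: measurable_W; exact: measurableC.
have tEC : trivIset setT (fun m => E `&` C m) by exact: trivIset_setIl.
rewrite setI_bigcupr; under eq_bigcupr do rewrite setIA.
rewrite measure_bigcup//=; last exact: trivIset_setIr.
have step m : (P (E `&` C m `&` W j @^-1` (~` B m)) <= (1 - p)%:E * P (E `&` C m))%E.
  rewrite past_independent//; [|exact: measurableI|exact: measurableC].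
  rewrite muleC lee_wpmul2r// preimage_setC probability_setC; last exact: measurable_W.
  by rewrite EFinB; apply: leeB => //; exact: pB.
rewrite (le_trans (lee_nneseries _ (fun m _ => step m)))//.
rewrite nneseriesZl//.
rewrite lee_wpmul2l ?lee_fin ?subr_ge0//.
rewrite -measure_bigcup//= -setI_bigcupr.
apply: le_measure; rewrite ?inE//; last exact: past_measurable.
by rewrite setI_bigcupr; exact: bigcup_measurable.
Qed.

End Filtration.

(** * Monotonicity of the integral *)

Section IntegralMonotone.
Context {R : realType} {d : measure_display} {X : measurableType d}.

(** Both integrals are suprema over the simple functions below the integrand,
    and a larger integrand has more of them. This is how the expected
    uncertainty is compared with the integral of a simple function. *)
Lemma ge0_integral_mono (mu : {measure set X -> \bar R}) (f g : X -> \bar R) :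
  (forall w, 0 <= f w)%E -> (forall w, f w <= g w)%E ->
  (\int[mu]_w f w <= \int[mu]_w g w)%E.
Proof.
move=> f0 fg.
have g0 w : (0 <= g w)%E by exact: le_trans (fg w).
rewrite !ge0_integralTE//; apply: le_ereal_sup => _ [h hf <-].
by exists h => // w; exact: le_trans (hf w) (fg w).
Qed.

End IntegralMonotone.

(** * The learning procedure *)

Section Compatible.
Context {R : realType} {k T : nat}.

(** The block matrix defining N maps (1, g) to (1, Y - g^T Ph), so that g is
    compatible with the data iff the residual is an admissible noise. *)
Lemma Zset_Nmx (Pi : 'M[R]_(1 + T)) (Y : 'rV[R]_T) (Ph : 'M[R]_(k, T)) g :
  Zset (Nmx Pi Y Ph) g <-> Zset Pi (Y^T - Ph^T *m g).
Proof.
rewrite /Zset /Nmx /=; set B := block_mx _ _ _ _.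
have BE : B^T *m col_mx 1%:M g = col_mx 1%:M (Y^T - Ph^T *m g).
  rewrite /B tr_block_mx mul_block_col trmx1 trmx0 mulmx1 mul0mx addr0 mulmx1.
  by rewrite linearN/= mulNmx.
by rewrite -BE trmx_mul trmxK !mulmxA.
Qed.

Lemma dotv_adjoint (M : 'M[R]_(k, T)) u x : dotv (M *m u) x = dotv u (M^T *m x).
Proof. by rewrite /dotv trmx_mul mulmxA. Qed.

Lemma dotv_delta i (x : 'cV[R]_k) : dotv (delta_mx i 0) x = x i 0.
Proof.
rewrite dotvE (bigD1 i)//= big1 ?addr0 ?mxE ?eqxx ?mul1r// => l li.
by rewrite mxE (negbTE li) mul0r.
Qed.

End Compatible.

Section Learning.
Context {R : realType} {n k T : nat}.
Variables (phi : 'I_k -> 'cV[R]_n -> R) (gh : 'cV[R]_k) (Pi : 'M[R]_(1 + T)).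
Hypothesis Pi_neg : pd (- drsubmx Pi).
Variable f : 'I_T -> 'cV[R]_n.
Hypothesis f_rank : forall x : 'cV[R]_n, row_free (PhiF phi f x).
Variable a : R.
Hypothesis a0 : 0 < a.
Hypothesis sigma_a : forall x : 'cV[R]_n, a <= sigma_min (PhiF phi f x).
Context {d : measure_display} {Omega : measurableType d} (P : probability Omega R).
Variable W : nat -> {RV P >-> Rtuple R T}.
Hypothesis W_mem : forall j w, Zset Pi (row_of_tuple (W j w))^T.
Hypothesis W_indep : mutually_independent W.
Hypothesis W_unif : forall j, (1 <= j)%N -> uniform_on (W j) (Zset Pi).
Variables (z0 : 'cV[R]_n) (z : nat -> Omega -> 'cV[R]_n).
Variable Gam : nat -> Omega -> set 'cV[R]_k.
Hypothesis Gam_mem : forall j w g, Gam j w g <->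
  Zset Pi ((row_of_tuple (W j w))^T + (PhiF phi f (z j w))^T *m (gh - g)).
Hypothesis conv0 : forall w g, Gam 0%N w g -> strictly_convex (phi_of phi g).
Hypothesis z_init : forall w, z 0%N w = z0.

Let K l w := \bigcap_(i in `I_l) Gam i w.

Hypothesis z_argmin : forall j w, (1 <= j)%N ->
  is_argmin (phi_plus phi (K j w)) [set z j.-1 w + y | y in conv_hull (range f)] (z j w).

Lemma phi_of_linear g x : phi_of phi g x = dotv g (Defs.basis phi x).
Proof. by []. Qed.

Lemma gh_Gam j w : Gam j w gh.
Proof. by apply/Gam_mem; rewrite subrr mulmx0 addr0. Qed.

Lemma gh_K l w : K l w gh.
Proof. by move=> i _; exact: gh_Gam. Qed.

Lemma right_inverse x i : exists u : 'cV[R]_T,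
  PhiF phi f x *m u = delta_mx i 0 /\ forall m, `|u m 0| <= a^-1.
Proof. exact: bounded_right_inverse. Qed.

(** Both W j w and W j w + Phi^T (gh - g) lie in the bounded set Z; pairing
    their difference with u such that Phi u = e_i gives the coordinates of gh - g. *)
Lemma param_bound : exists2 M : R, 0 <= M &
  forall j w g, Gam j w g -> `|gh - g| <= M.
Proof.
have [b b0 Zb] := Zset_bounded Pi_neg.
have a10 : 0 <= a^-1 by rewrite invr_ge0 ltW.
have M0 : 0 <= T%:R * (a^-1 * (b + b)) by rewrite !mulr_ge0// addr_ge0// ltW.
exists (T%:R * (a^-1 * (b + b))) => // j w g /Gam_mem Zg.
apply: norm_le_coord => // i l; rewrite ord1.
have [u [Phu ua]] := right_inverse (z j w) i.
rewrite -dotv_delta -Phu dotv_adjoint (le_trans (dotv_norm _ ua))//.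
rewrite ler_wpM2l// ler_wpM2l//.
set v := _ *m _ in Zg *; set r := (row_of_tuple _)^T in Zg.
have -> : v = (r + v) - r by rewrite [r + v]addrC addrK.
by rewrite (le_trans (ler_normB _ _))// lerD// Zb//; exact: W_mem.
Qed.

Lemma phi_of_diff g g' s i x : g = g' + s *: delta_mx i 0 ->
  phi_of phi g x - phi_of phi g' x = s * phi i x.
Proof.
move=> ->; rewrite !phi_of_linear dotvC dotvDr dotvZr [dotv _ g']dotvC.
by rewrite [dotv _ (delta_mx _ _)]dotvC dotv_delta mxE addrAC subrr add0r.
Qed.

(** The set Gam 0 w is a slice of an ellipsoid; containing two points, it has
    an interior point gm. Hence a multiple of each basis function is the
    difference of phi_of gm and phi_of (gm + s e_i), both strictly
    convex, hence continuous. *)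
Lemma basis_continuous w g : Gam 0%N w g -> g != gh -> forall i, continuous (phi i).
Proof.
move=> Gg ggh i; have /Gam_mem Zg := Gg.
set F := PhiF phi f _ in Zg; set r0 := (row_of_tuple _)^T in Zg.
have FD : F^T *m (gh - g) != 0.
  apply: contra ggh => /eqP F0; apply/eqP/esym/eqP.
  rewrite -subr_eq0; apply/eqP/colP => l; rewrite [RHS]mxE -dotv_delta.
  have [u [<- _]] := right_inverse (z 0%N w) l.
  by rewrite dotv_adjoint F0 /dotv mulmx0 mxE.
have Zr0 : Zset Pi r0 by exact: W_mem.
have xy : r0 + F^T *m (gh - g) != r0.
  by rewrite -subr_eq0 addrAC subrr add0r.
have [r r_gt0 rZ] := Zset_interior Pi_neg Zg Zr0 xy.
pose gm := 2^-1 *: g + (1 - 2^-1) *: gh.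
pose s := r / (`|F^T *m (delta_mx i 0 : 'cV[R]_k)| + 1).
have F1 : 0 < `|F^T *m (delta_mx i 0 : 'cV[R]_k)| + 1 by rewrite ltr_wpDl.
have s0 : 0 < s by rewrite divr_gt0.
have Gs t : 0 <= t <= s -> Gam 0%N w (gm + t *: delta_mx i 0).
  move=> /andP[t0 ts]; apply/Gam_mem; apply: rZ; rewrite -/F -/r0.
  set c := _ + (1 - 2^-1) *: r0.
  have -> : c - (r0 + F^T *m (gh - (gm + t *: delta_mx i 0))) =
      t *: (F^T *m (delta_mx i 0 : 'cV[R]_k)).
    rewrite /c /gm !(mulmxDr, mulmxBr, mulmxN, =^~ scalemxAr, scalerDr, opprD).
    by apply/colP => l; rewrite !mxE; field.
  rewrite normrZ ger0_norm// (@le_trans _ _ (s * (`|F^T *m (delta_mx i 0 : 'cV[R]_k)| + 1)))//.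
    by rewrite ler_pM// lerDl.
  by rewrite /s divfK// gt_eqF.
have Cs t : 0 <= t <= s -> continuous (phi_of phi (gm + t *: delta_mx i 0)).
  by move=> /Gs/conv0; exact: strictly_convex_continuous.
have -> : phi i = (fun x => s^-1 * (phi_of phi (gm + s *: delta_mx i 0) x -
    phi_of phi (gm + 0 *: delta_mx i 0) x)).
  apply/funext => x; rewrite (@phi_of_diff _ (gm + 0 *: delta_mx i 0) s i x).
    by rewrite mulKf// gt_eqF.
  by rewrite scale0r addr0.
move=> x; apply: (@continuousM R 'cV[R]_n (fun=> s^-1)); first exact: cst_continuous.
apply: (@continuousB R R^o 'cV[R]_n); apply: Cs; rewrite lexx ltW//.
Qed.

(** The probability that the noise falls in the box of Zset_cap is the ratio
    of the volume of that box to the volume of Z, which is the same for all u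
    under consideration. Having positive volume, Z contains two points and
    therefore a ball. *)
Lemma likely_cap U delta : (0 < T)%N -> 0 <= U -> 0 < delta ->
  exists p : R, [/\ 0 < p, p <= 1 & forall u : 'cV[R]_T,
  exists B : set (Rtuple R T), [/\ measurable B,
    forall j, (1 <= j)%N -> (p%:E <= P (W j @^-1` B))%E &
    (forall m, `|u m 0| <= U) -> forall w, B w -> forall v, Zset Pi v ->
      dotv u v <= dotv u (row_of_tuple w)^T + delta]].
Proof.
move=> T0 U0 delta0.
set Zt := [set w : Rtuple R T | Zset Pi (row_of_tuple w)^T].
have /andP[mu0 muoo] : (0 < lebesgue_tuple R T Zt < +oo)%E.
  by have [] := W_unif (leqnn 1).
pose V := fine (lebesgue_tuple R T Zt).
have V0 : 0 < V by rewrite fine_gt0// mu0.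
have [x [y [Zx Zy xy]]] : exists x y, [/\ Zset Pi x, Zset Pi y & x != y].
  apply: contrapT => H.
  have [w0 Zw0] : Zt !=set0.
    by apply/set0P; apply: contraTneq mu0 => ->; rewrite measure0 ltxx.
  suff ZE : Zt = box (tnth w0) 0.
    by move: mu0; rewrite ZE lebesgue_box// mul0rn expr0n eqn0Ngt T0 ltxx.
  apply/seteqP; split => [w Zw i|w w0w].
    rewrite normr_le0 subr_eq0; apply/eqP; apply: contrapT => wi; apply: H.
    exists (row_of_tuple w0)^T, (row_of_tuple w)^T; split => //.
    by apply/eqP => /colP/(_ i); rewrite !mxE.
  suff -> : w = w0 by [].
  by apply: eq_from_tnth => i; apply/eqP; rewrite eq_sym -subr_eq0 -normr_le0; exact: w0w.
have [r0 r00 cZ] := Zset_interior Pi_neg Zx Zy xy.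
have [r r_gt0 capP] := Zset_cap Pi_neg r00 cZ U0 delta0.
have PB j (o : 'I_T -> R) : (1 <= j)%N -> box o r `<=` Zt ->
    P (W j @^-1` box o r) = (V^-1 * (r *+ 2) ^+ T)%:E.
  move=> j1 oZ; have [_ /(_ _ (measurable_box o r))] := W_unif j1.
  rewrite /distribution /pushforward => ->.
  rewrite (eq_integral (fun=> (V^-1)%:E)); last first.
    by move=> w /[1!inE] ow; rewrite indicE mem_set ?mulr1//; exact: oZ.
  rewrite integral_cst//; last exact: measurable_box.
  by rewrite [X in (_ * X)%E]lebesgue_box ?EFinM// ltW.
pose p := Num.min 1 (V^-1 * (r *+ 2) ^+ T).
exists p; split.
- by rewrite lt_min ltr01 mulr_gt0 ?invr_gt0// exprn_gt0// mulrn_wgt0.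
- by rewrite ge_min lexx.
(* The second property is also claimed for large u, where u' = 0 supplies B. *)
move=> u; pose u' := if `[< forall m, `|u m 0| <= U >] then u else 0.
have u'U m : `|u' m 0| <= U.
  by rewrite /u'; case: asboolP => [|_]; [exact|rewrite mxE normr0].
have [cb oP] := capP u' u'U.
have nearo w : box (fun i => cb i 0) r w -> `|cb - (row_of_tuple w)^T| <= r.
  by move=> bw; apply: norm_le_coord => [|i l]; [exact: ltW|rewrite !mxE ord1].
exists (box (fun i => cb i 0) r); split=> [|j j1|uU w /nearo/oP[_]]; first exact: measurable_box.
  rewrite PB// => [|w /nearo/oP[]//].
  by rewrite lee_fin ge_min lexx orbT.
by rewrite /u' asboolT.
Qed.

Let form i w g : R :=
  let v := (row_of_tuple (W i w))^T + (PhiF phi f (z i w))^T *m (gh - g) in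
  bilin Pi (col_mx 1%:M v) (col_mx 1%:M v).

Let Gam_form i w g : Gam i w g <-> 0 <= form i w g.
Proof. exact: Gam_mem. Qed.

Let form_continuous i w : continuous (form i w).
Proof.
apply: continuous_Zform => m.
set F := PhiF phi f _; set r := (row_of_tuple _)^T.
have -> : (fun g => (r + F^T *m (gh - g)) m 0) =
    (fun g => (r m 0 + dotv (col m F) gh) - dotv (col m F) g).
  apply/funext => g; rewrite -addrA -dotvBr [LHS]mxE; congr (_ + _).
  by rewrite dotvE mxE; apply: eq_bigr => l _; rewrite !mxE.
move=> g; apply: (@continuousB R R^o 'cV[R]_k); first exact: cst_continuous.
exact: dotv_continuous.
Qed.

Let K_compact l w : (0 < l)%N -> compact (K l w).
Proof.
move=> l0; have [M M0 GM] := param_bound.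
have M1 : 0 < M + 1 by rewrite ltr_wpDl.
apply: (@subclosed_compact _ _ [set g : 'cV[R]_k | `|gh - g| <= M + 1]).
- apply: closed_bigI => i _.
  rewrite (_ : Gam i w = form i w @^-1` [set x | 0 <= x]).
    by apply: closed_comp => [g _|]; [exact: form_continuous|exact: closed_ge].
  by apply/seteqP; split => g /=; rewrite -Gam_form.
- exact: cball_compact.
- by move=> g /(_ 0%N l0)/GM gM; rewrite /= (le_trans gM)// lerDl.
Qed.

Let phi_of_continuous_param x : continuous (phi_of phi ^~ x).
Proof.
have -> : phi_of phi ^~ x = dotv (Defs.basis phi x).
  by apply/funext => g; rewrite phi_of_linear dotvC.
exact: dotv_continuous.
Qed.

Lemma phi_plus_attained l w x : (0 < l)%N -> exists g,
  [/\ K l w g, phi_plus phi (K l w) x = (phi_of phi g x)%:E &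
    forall g', K l w g' -> phi_of phi g' x <= phi_of phi g x].
Proof.
move=> l0; have [|g /[1!inE] Kg gmax] := compact_EVT_max _ (@K_compact l w l0)
  (continuous_subspaceT (@phi_of_continuous_param x)).
  by exists gh; exact: gh_K.
have {}gmax g' : K l w g' -> phi_of phi g' x <= phi_of phi g x.
  by move=> Kg'; apply: gmax; rewrite inE.
exists g; split => //; apply/eqP; rewrite eq_le; apply/andP; split.
  by apply: ge_ereal_sup => _ [g' Kg' <-]; rewrite lee_fin gmax.
by apply: ereal_sup_ubound; exists g.
Qed.

Let p l w x : R := fine (phi_plus phi (K l w) x).

Let phi_plusE l w x : (0 < l)%N -> phi_plus phi (K l w) x = (p l w x)%:E.
Proof. by move=> l0; rewrite /p; have [g [_ -> _]] := phi_plus_attained w x l0. Qed.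

Let p_ge l w x g : (0 < l)%N -> K l w g -> phi_of phi g x <= p l w x.
Proof.
by move=> l0 Kg; rewrite /p; have [g' [_ -> ]] := phi_plus_attained w x l0; exact.
Qed.

(** The supremum at an intermediate point is attained, by a function which is
    strictly convex and below the supremum at both end points. *)
Lemma phi_plus_strictly_convex l w : (0 < l)%N -> strictly_convex (p l w).
Proof.
move=> l0 x y t xy /andP[t0 t1].
have [g [Kg pg _]] := phi_plus_attained w (t *: x + (1 - t) *: y) l0.
rewrite {1}/p pg /= (lt_le_trans (conv0 (Kg 0%N l0) xy _)) ?t0//.
by rewrite lerD// ler_wpM2l ?p_ge// ?subr_ge0 ltW.
Qed.

(** By strong induction on l. The function minimised at step l + 1 is the
    maximum of phi_of g over the parameters compatible with the first l + 1
    measurements, a compact set cut out by inequalities that are continuous in g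
    and depend measurably on the past; so measurable_max_on and measurable_argmin
    apply. The statement concerns the values phi i (z l w + y) because these are
    all that the measurements see of z l. *)
Lemma step_measurable (phi_cont : forall i, continuous (phi i)) j l : (l <= j)%N ->
  forall i y, measurable_fun setT (fun w : past W j => phi i (z l w + y)).
Proof.
elim/ltn_ind: l => -[_ _ i y|l IH lj i y].
  under eq_fun do rewrite z_init; exact: measurable_cst.
have mform m : (m < l.+1)%N ->
    caratheodory (fun (w : past W j) g => form m w g).
  move=> ml; split => [g|w]; last exact: form_continuous.
  apply: measurable_Zform => r.
  have -> : (fun w : past W j =>
      ((row_of_tuple (W m w))^T + (PhiF phi f (z m w))^T *m (gh - g)) r 0) =
      (fun w => tnth (W m w) r + \sum_s phi s (z m w + f r) * (gh - g) s 0).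
    apply/funext => w; rewrite [LHS]mxE !mxE; congr (_ + _).
    by apply: eq_bigr => s _; rewrite !mxE.
  apply: measurable_funD.
    apply: (measurableT_comp (measurable_tnth r)).
    by apply: measurable_past_W; exact: leq_trans lj.
  apply: measurable_sum => s; apply: measurable_funM => //.
  by apply: IH => //; rewrite (leq_trans _ lj)// ltnW.
have mphi_of g x : measurable_fun setT (fun w : past W j => phi_of phi g (z l w + x)).
  under eq_fun do rewrite phi_of_linear dotvE.
  apply: measurable_sum => s; apply: measurable_funM => //.
  under eq_fun do rewrite mxE.
  by apply: IH => //; exact: ltnW.
have [M M0 GM] := param_bound; have M1 : 0 < M + 1 by rewrite ltr_wpDl.
pose S := closure (conv_hull (range f)).
pose pz (w : past W j) x := p l.+1 w (z l w + x).
have scpz w : strictly_convex (pz w).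
  by apply: strictly_convex_translate; exact: phi_plus_strictly_convex.
have cpz : caratheodory pz.
  split => [x|w]; last exact: strictly_convex_continuous.
  apply: (@measurable_max_on _ _ (past W j) _ _ _
    (fun (m : 'I_l.+1) (w : past W j) g => form m w g)
    (fun w g => phi_of phi g (z l w + x)) (fun w => pz w x) (@cball_compact R k gh _ M1)).
  - by move=> m; exact: mform.
  - by split => [g|w]; [exact: mphi_of|exact: phi_of_continuous_param].
  - move=> w; have [g [Kg pg _]] := phi_plus_attained w (z l w + x) (ltn0Sn l).
    exists g; last by rewrite /pz /p pg.
    split; first by rewrite /= (le_trans (GM _ _ _ (Kg 0%N (ltn0Sn l))))// lerDl.
    by move=> m; apply/Gam_form/Kg => /=.
  - move=> w g _ gm; apply: p_ge => // m /= ml; apply/Gam_form.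
    exact: gm (Ordinal ml).
pose B := \sum_i `|f i| + 1.
have B0 : 0 < B by rewrite ltr_wpDl// sumr_ge0.
have fB x : range f x -> `|x| <= B.
  by move=> [s _ <-]; rewrite /B (bigD1 s)//= -addrA lerDl addr_ge0// sumr_ge0.
have cS : compact S by exact: conv_hull_compact fB.
pose ymin (w : past W j) := z l.+1 w - z l w.
have [ymin_in ymin_min] : (forall w, conv_hull (range f) (ymin w)) /\
    (forall w x, conv_hull (range f) x -> pz w (ymin w) <= pz w x).
  split=> w.
    rewrite /ymin; have [[x Hx <-] _] := z_argmin w (ltn0Sn l).
    by rewrite /= addrAC subrr add0r.
  move=> x Hx; have [_ /(_ (z l w + x))] := z_argmin w (ltn0Sn l).
  rewrite !phi_plusE// lee_fin /pz /ymin addrCA subrr addr0; apply.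
  by exists x.
have argS w := strictly_convex_argmin_closure (@conv_hull_midpoint _ _ _)
  (scpz w) (ymin_in w) (ymin_min w).
rewrite (_ : (fun _ => _) = (fun w : past W j => phi i (z l w + ymin w + y))); last first.
  by apply/funext => w; rewrite /ymin addrCA subrr addr0.
apply: (measurable_argmin (g := fun (w : past W j) x => phi i (z l w + x + y)) cS cpz).
- split => [x|w].
    under eq_fun do rewrite -addrA; apply: IH => //; exact: ltnW.
  under eq_fun do rewrite addrAC; exact: translate_continuous.
- by move=> w; apply: subset_closure; exact: ymin_in.
- by move=> w x Sx; have [] := argS w x Sx.
- by move=> w x Sx; have [] := argS w x Sx.
Qed.

(** E J is the event that all the samples 1, ..., J miss their targets. The
    target at step j lies in the cap of Z in the direction q m, where m is the
    first index for which Phi (z j) maps q m close to s e_i. When the target is hit,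
    every compatible parameter satisfies, up to the error of this approximation,
    s (gh - g)_i = dotv (q m) (Phi^T (gh - g)) <= delta / 2. Replacing the exact
    solution of Phi u = s e_i by a term of a dense sequence makes the choice of
    the target measurable and countable. *)
Lemma coordinate_decay (phi_cont : forall i, continuous (phi i)) i (s delta : R) :
  `|s| = 1 -> 0 < delta ->
  exists (E : nat -> set Omega) (c : R), [/\ forall J, measurable (E J), 0 <= c < 1,
    forall J, (P (E J) <= (c ^+ J)%:E)%E &
    forall J w g, ~ E J w -> K J.+1 w g -> s * (gh - g) i 0 <= delta].
Proof.
move=> s1 delta0.
have T0 : (0 < T)%N.
  have [T0|//] := posnP T; have [u [/matrixP/(_ i 0) + _]] := right_inverse z0 i.
  rewrite !mxE !eqxx big1 => [/esym/eqP|l _]; first by rewrite oner_eq0.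
  by have := ltn_ord l; rewrite {2}T0.
have a10 : 0 < a^-1 by rewrite invr_gt0.
have [M M0 GM] := param_bound.
pose U := a^-1 + a^-1; have U0 : 0 <= U by rewrite addr_ge0 ?ltW.
have d20 : 0 < delta / 2 by rewrite divr_gt0.
have [pr [pr0 pr1 /choice[B BP]]] := likely_cap T0 U0 d20.
have kM1 : 0 < k%:R * M + 1 by rewrite ltr_wpDl// mulr_ge0.
pose eta := delta / 2 / (k%:R * M + 1).
have eta0 : 0 < eta by rewrite divr_gt0.
have etaM : k%:R * (eta * M) <= delta / 2.
  rewrite mulrCA -/eta (@le_trans _ _ (eta * (k%:R * M + 1)))//.
    by rewrite ler_wpM2l ?lerDl// ltW.
  by rewrite /eta divfK// gt_eqF.
have [q0 q0_dense] := @cV_dense R T.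
(* Terms beyond the bound U are replaced by 0, to which likely_cap applies. *)
pose q m := if `[< forall l, `|q0 m l 0| <= U >] then q0 m else 0.
have qU m l : `|q m l 0| <= U.
  by rewrite /q; case: asboolP => [|_]; [exact|rewrite mxE normr0].
pose good j m : set Omega := [set w | forall l,
  `|(PhiF phi f (z j w) *m q m - s *: delta_mx i 0) l 0| <= eta].
have good_cover j w : exists m, good j m w.
  set F := PhiF phi f (z j w); have [u [Fu ua]] := right_inverse (z j w) i.
  have TF1 : 0 < T%:R * `|F| + 1 by rewrite ltr_wpDl// mulr_ge0.
  pose r := Num.min a^-1 (eta / (T%:R * `|F| + 1)).
  have r0 : 0 < r by rewrite lt_min a10 divr_gt0.
  have [m] := q0_dense (s *: u) r r0; rewrite lt_min => /andP[um1 um2].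
  have qq : q m = q0 m.
    rewrite /q asboolT// => l.
    have := coord_le_norm (s *: u - q0 m) l 0; rewrite !mxE => H.
    have := ler_normB (s * u l 0) (s * u l 0 - q0 m l 0).
    rewrite opprB addrCA subrr addr0 normrM s1 mul1r => /le_trans; apply.
    by rewrite lerD// (le_trans H)// ltW.
  exists m => l; rewrite /= qq -/F -Fu.
  have -> : (F *m q0 m - s *: (F *m u)) l 0 = - dotv (row l F)^T (s *: u - q0 m).
    rewrite /dotv trmxK mulmxBr -row_mul -row_mul -scalemxAr !mxE opprB.
    by congr (_ - _); rewrite !mxE.
  rewrite normrN (le_trans (dotv_norm (U := `|F|) _ _))//.
    by move=> t; rewrite mxE mxE coord_le_norm.
  rewrite mulrA (@le_trans _ _ ((T%:R * `|F| + 1) * (eta / (T%:R * `|F| + 1))))//.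
    by rewrite ler_pM ?mulr_ge0 ?lerDl// ltW.
  by rewrite mulrC divfK// gt_eqF.
have mgood J j m : (j <= J)%N -> measurable (good j m : set (past W J)).
  move=> jJ; rewrite (_ : good j m = \bigcap_(l in [set: 'I_k]) [set w : past W J |
      `|(PhiF phi f (z j w) *m q m - s *: delta_mx i 0) l 0| <= eta]); last first.
    by apply/seteqP; split => [w H l _|w H l]; [exact: H|exact: H].
  apply: fin_bigcap_measurable => // l _.
  apply: measurable_ge_fun; last exact: measurable_cst.
  apply: measurableT_comp; first exact: normr_measurable.
  have -> : (fun w : past W J => (PhiF phi f (z j w) *m q m - s *: delta_mx i 0) l 0) =
      (fun w => \sum_t phi l (z j w + f t) * q m t 0 - (s *: (delta_mx i 0 : 'cV[R]_k)) l 0).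
    apply/funext => w; rewrite [LHS]mxE !mxE; congr (_ - _).
    by apply: eq_bigr => t _; rewrite !mxE.
  apply: measurable_funB; last exact: measurable_cst.
  apply: measurable_sum => t; apply: measurable_funM; last exact: measurable_cst.
  exact: step_measurable.
have mB m : measurable (B (q m)) by have [] := BP (q m).
pose C j := seqDU (good j).
have mC J j m : (j <= J)%N -> measurable (C j m : set (past W J)).
  move=> jJ; apply: (@measurableD _ (past W J)); first exact: mgood.
  by apply: (@bigsetU_measurable _ (past W J)) => l _; exact: mgood.
pose N j := \bigcup_m (C j m `&` W j @^-1` (~` B (q m))).
have mN J j : (j < J)%N -> measurable (N j : set (past W J)).
  move=> jJ; apply: bigcupT_measurable => m; apply: measurableI; first by apply: mC; exact: ltnW.
  rewrite -[X in measurable X]setTI.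
  exact: (@measurable_past_W _ _ _ _ _ W _ _ jJ measurableT _ (measurableC (mB m))).
pose E J := \bigcap_(j in `I_J) N j.+1.
have mE J : measurable (E J : set (past W J.+1)).
  by apply: fin_bigcap_measurable => // j /= jJ; exact: mN.
exists E, (1 - pr); split.
- by move=> J; apply: past_measurable; exact: mE.
- by apply/andP; split; lra.
- elim=> [|J IH]; first by rewrite expr0 probability_le1//; exact: past_measurable (mE 0%N).
  have -> : E J.+1 = E J `&` N J.+1.
    apply/seteqP; split => [w H|w [H1 H2] j /=].
      by split=> [j /= jJ|]; apply: H => //=; exact: ltnW.
    by rewrite ltnS leq_eqVlt => /predU1P[->//|]; exact: H1.
  have pB m : (pr%:E <= P (W J.+1 @^-1` B (q m)))%E.
    by have [_ /(_ J.+1 isT)] := BP (q m).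
  have := past_decay W_indep (mE J) (fun m => mC _ _ m (leqnn _)) (@trivIset_seqDU _ _) mB pB pr1.
  move=> /le_trans; apply.
  by rewrite exprS EFinM lee_wpmul2l// lee_fin; lra.
- move=> J w g nE Kg.
  have [j jJ nN] : exists2 j, (j < J)%N & ~ N j.+1 w.
    apply: contrapT => H; apply: nE => j /= jJ; apply: contrapT => nN.
    by apply: H; exists j.
  have [m _ Cm] : (\bigcup_m C j.+1 m) w.
    by rewrite /C -seqDU_bigcup_eq; have [m gm] := good_cover j.+1 w; exists m.
  have Bw : B (q m) (W j.+1 w).
    by apply: contrapT => nB; apply: nN; exists m.
  have [_ _ /(_ (qU m) _ Bw)] := BP (q m).
  have /Gam_mem Zg : Gam j.+1 w g by exact: Kg.
  move=> /(_ _ Zg); rewrite dotvDr lerD2l -dotv_adjoint => H.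
  have gm : good j.+1 m w by exact: subset_seqDU Cm.
  have := dotv_norm (gh - g) gm.
  have gM : `|gh - g| <= M by exact: GM (Kg 0%N _).
  have : k%:R * (eta * `|gh - g|) <= delta / 2.
    by rewrite (le_trans _ etaM)// ler_wpM2l// ler_wpM2l// ltW.
  rewrite dotvC dotvBr dotvZr [dotv _ (delta_mx i 0)]dotvC dotv_delta [dotv (gh - g) _]dotvC.
  move=> H1 H2; have := le_trans H2 H1; rewrite ler_norml => /andP[H3 _]; lra.
Qed.

Lemma uncertainty_le x (G : set 'cV[R]_k) delta :
  (forall g, G g -> `|gh - g| <= delta) ->
  (uncertainty phi x G <= (delta * (k%:R * `|Defs.basis phi x|) *+ 2)%:E)%E.
Proof.
move=> Gd; set B := k%:R * _.
have dB g : G g -> `|phi_of phi gh x - phi_of phi g x| <= delta * B.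
  move=> Gg; rewrite !phi_of_linear -![dotv _ (Defs.basis _ _)]dotvC -dotvBr.
  rewrite (le_trans (dotv_norm (U := `|Defs.basis phi x|) _ _))//.
    by move=> l; exact: coord_le_norm.
  by rewrite mulrA -/B mulrC ler_wpM2r ?mulr_ge0// Gd.
rewrite mulr2n EFinD /uncertainty.
have up : (phi_plus phi G x <= (phi_of phi gh x + delta * B)%:E)%E.
  apply: ge_ereal_sup => _ [g Gg <-]; rewrite lee_fin.
  by have := dB g Gg; rewrite ler_distlC => /andP[]; lra.
have dn : ((phi_of phi gh x - delta * B)%:E <= phi_minus phi G x)%E.
  apply: le_ereal_inf_tmp => _ [g Gg <-]; rewrite lee_fin.
  by have := dB g Gg; rewrite ler_distlC => /andP[]; lra.
rewrite (le_trans (leeB up dn))// -EFinB -EFinD lee_fin; lra.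
Qed.

Lemma uncertainty_ge0 x (G : set 'cV[R]_k) : G gh -> (0 <= uncertainty phi x G)%E.
Proof.
move=> Ggh; rewrite -(@subee _ (phi_of phi gh x)%:E)//.
apply: leeB; first by apply: ereal_sup_ubound; exists gh.
by apply: ereal_inf_lbound; exists gh.
Qed.

(** Outside the 2k events of coordinate_decay, all coordinates of the error
    are at most delta and the uncertainty is at most e; inside, it is bounded by a
    constant D. The expectation is thus at most e plus D times the sum of the
    probabilities of these events, which decrease geometrically. *)
Lemma expected_uncertainty_cvg0 x :
  ((fun J => \int[P]_w uncertainty phi x (K J.+1 w)) @ \oo --> 0)%E.
Proof.
have U0 J w : (0 <= uncertainty phi x (K J.+1 w))%E by exact/uncertainty_ge0/gh_K.
(* If every Gam 0 w is the singleton of gh, then so are all intersections and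
   the uncertainty vanishes. *)
have [[w0 [g0 [Gg0 gg0]]]|H] := pselect (exists w g, Gam 0%N w g /\ g != gh); last first.
  rewrite (_ : (fun _ => _) = fun=> 0%E); first exact: cvg_cst.
  apply/funext => J; apply: integral0_eq => w _; apply/eqP; rewrite eq_le U0 andbT.
  rewrite (le_trans (@uncertainty_le _ _ 0 _)) ?mul0r ?mul0rn// => g Kg.
  have [->|ggh] := eqVneq g gh; first by rewrite subrr normr0.
  by exfalso; apply: H; exists w, g; split => //; exact: Kg.
have phi_cont := basis_continuous Gg0 gg0.
have [M M0 GM] := param_bound.
pose B := k%:R * `|Defs.basis phi x|; have B0 : 0 <= B by rewrite mulr_ge0.
have bound e : 0 < e -> exists2 v : nat -> R, v @ \oo --> 0 &
    forall J, (\int[P]_w uncertainty phi x (K J.+1 w) <= (e + v J)%:E)%E.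
  move=> e0; pose delta := e / 2 / (B + 1).
  have B1 : 0 < B + 1 by rewrite ltr_wpDl.
  have delta0 : 0 < delta by rewrite !divr_gt0.
  have deltaB : delta * B *+ 2 <= e.
    have : delta * B <= delta * (B + 1) by rewrite ler_wpM2l ?lerDl// ltW.
    by rewrite mulr2n [delta * (B + 1)]divfK ?gt_eqF// => H; rewrite [leRHS]splitr lerD.
  have s1 (b : bool) : `|(-1) ^+ b| = 1 :> R by rewrite normr_sign.
  have /choice[E] := fun ib : 'I_k * bool =>
    coordinate_decay phi_cont ib.1 (s1 ib.2) delta0.
  move=> /choice[c EP].
  have D0 : 0 <= M * B *+ 2 by rewrite mulrn_wge0// mulr_ge0.
  pose D := M * B *+ 2.
  exists (fun J => \sum_ib D * c ib ^+ J).
    rewrite [X in _ --> X](_ : 0 = \sum_(ib : 'I_k * bool) (0 : R)); last by rewrite big1.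
    apply: cvg_big => [|ib _]; first by move=> xy; exact: add_continuous.
    rewrite -(mulr0 D); apply: cvgM; first exact: cvg_cst.
    apply: cvg_expr; have [_ /andP[c0 c1] _ _] := EP ib.
    by rewrite ger0_norm.
  move=> J; have mE ib : measurable (E ib J) by have [] := EP ib.
  have Ule w : (uncertainty phi x (K J.+1 w) <=
      (e%:E + \sum_ib (D * \1_(E ib J) w)%:E))%E.
    have sum0 (A : pred ('I_k * bool)) : (0 <= \sum_(ib | A ib) (D * \1_(E ib J) w)%:E)%E.
      by apply: sume_ge0 => ib _; rewrite lee_fin mulr_ge0// indicE.
    have [[ib Ew]|nE] := pselect (exists ib, E ib J w).
      have KM g : K J.+1 w g -> `|gh - g| <= M by move=> Kg; exact: GM (Kg 0%N _).
      rewrite (le_trans (uncertainty_le _ KM))// (bigD1 ib)//= indicE mem_set// mulr1.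
      rewrite addeC -addeA leeDl// adde_ge0// lee_fin ltW//.
    have Kd g : K J.+1 w g -> `|gh - g| <= delta.
      move=> Kg; apply: norm_le_coord => [|l t]; [exact: ltW|rewrite ord1 ler_norml].
      have sE (b : bool) : (-1) ^+ b * (gh - g) l 0 <= delta.
        have [_ _ _ /(_ J w g)] := EP (l, b); apply => // Elb.
        by apply: nE; exists (l, b).
      have := sE false; have := sE true; rewrite expr0 expr1 mulN1r mul1r => H1 H2.
      by apply/andP; split=> //; rewrite lerNl.
    rewrite (le_trans (uncertainty_le _ Kd))// (@le_trans _ _ e%:E) ?lee_fin//.
    by rewrite leeDl.
  have mD ib : measurable_fun setT (fun w => (D * \1_(E ib J) w)%:E).
    by apply/measurable_EFinP; apply: measurable_funM.
  have D0' ib w : (0 <= (D * \1_(E ib J) w)%:E)%E by rewrite lee_fin mulr_ge0// indicE.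
  rewrite (le_trans (ge0_integral_mono P (U0 J) Ule))//.
  rewrite ge0_integralD//; first last.
  - exact: emeasurable_sum.
  - by move=> w _; exact: sume_ge0.
  - by move=> w _; rewrite lee_fin ltW.
  rewrite integral_cst// [X in (_ * X)%E](_ : _ = 1%E); last exact: probability_setT.
  rewrite mule1 EFinD leeD2l//.
  rewrite ge0_integral_sum// -sumEFin; apply: lee_sum => ib _.
  under eq_integral do rewrite EFinM.
  rewrite ge0_integralZl_EFin//; last exact/measurable_EFinP.
  rewrite integral_indic// setIT EFinM lee_wpmul2l// ?lee_fin//.
  by have [_ _ /(_ J)] := EP ib.
have I0 l : (0 <= \int[P]_w uncertainty phi x (K l.+1 w))%E by exact: integral_ge0.
have [v1 _ v1b] := bound 1 ltr01.
have Ifin J : (\int[P]_w uncertainty phi x (K J.+1 w))%E \is a fin_num.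
  by rewrite ge0_fin_numE// (le_lt_trans (v1b J))// ltry.
apply/fine_cvgP; split; first by apply: nearW.
apply/cvgr0Pnorm_le => e e0.
have e20 : 0 < e / 2 by rewrite divr_gt0.
have [v v0 vb] := bound _ e20.
near=> J => /=.
rewrite ger0_norm ?fine_ge0// -lee_fin fineK// (le_trans (vb J))// lee_fin.
rewrite [leRHS](splitr e) lerD2l (le_trans (ler_norm _))//.
by near: J; move/cvgr0Pnorm_le : v0; exact.
Unshelve. all: by end_near. Qed.
End Learning.

Unset Implicit Arguments.

Theorem mainTheorem9 (R : realType) (n k T : nat)
  (phi : 'I_k -> 'cV[R]_n -> R) (gamma_hat : 'cV[R]_k)
  (Pi : 'M[R]_(1 + T))
  (hPi_sym : Pi^T = Pi)
  (hPi_neg : pd (- drsubmx Pi))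
  (hPi_schur : 0 <= schur Pi)
  (f : 'I_T -> 'cV[R]_n)
  (hf_int : (conv_hull (range f))° 0)
  (hf_rank : forall x : 'cV[R]_n, row_free (PhiF phi f x))
  (a : R) (ha : 0 < a)
  (hsigma : forall x : 'cV[R]_n, a <= sigma_min (PhiF phi f x))
  (d : measure_display) (Omega : measurableType d) (P : probability Omega R)
  (W : nat -> {RV P >-> Rtuple R T})
  (hW_mem : forall (j : nat) (w : Omega), Zset Pi (row_of_tuple (W j w))^T)
  (hW_indep : mutually_independent W)
  (hW_unif : forall j : nat, (1 <= j)%N -> uniform_on (W j) (Zset Pi))
  (z0 : 'cV[R]_n)
  (z : nat -> Omega -> 'cV[R]_n)
  (Y : nat -> Omega -> 'rV[R]_T)
  (Gam : nat -> Omega -> set 'cV[R]_k)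
  (hY : forall (j : nat) (w : Omega),
    Y j w = gamma_hat^T *m PhiF phi f (z j w) + row_of_tuple (W j w))
  (hGam : forall (j : nat) (w : Omega),
    Gam j w = Zset (Nmx Pi (Y j w) (PhiF phi f (z j w))))
  (hconv : forall (w : Omega) (gamma : 'cV[R]_k),
    Gam 0%N w gamma -> strictly_convex (phi_of phi gamma))
  (hz0 : forall w : Omega, z 0%N w = z0)
  (hz : forall (j : nat) (w : Omega), (1 <= j)%N ->
    is_argmin (phi_plus phi (\bigcap_(i in `I_j) Gam i w))
              [set z j.-1 w + y | y in conv_hull (range f)]
              (z j w)) :
  forall x : 'cV[R]_n,
    (forall (j : nat) (w : Omega), (1 <= j)%N ->
       (uncertainty phi x (\bigcap_(i in `I_j) Gam i w) >=
        uncertainty phi x (\bigcap_(i in `I_j.+1) Gam i w))%E) /\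
    (fun j : nat =>
       \int[P]_w uncertainty phi x (\bigcap_(i in `I_j.+1) Gam i w))%E
      @ \oo --> 0%E.
Proof.
have Gam_mem j w g : Gam j w g <->
    Zset Pi ((row_of_tuple (W j w))^T + (PhiF phi f (z j w))^T *m (gamma_hat - g)).
  rewrite hGam Zset_Nmx hY linearD/= trmx_mul trmxK mulmxBr.
  by rewrite addrAC addrC.
move=> x; split=> [j w j1|].
  apply: leeB.
    by apply: le_ereal_sup => _ [g Kg <-]; exists g => // i ij; apply: Kg; exact: ltnW.
  by apply: ereal_inf_le_tmp => _ [g Kg <-]; exists g => // i ij; apply: Kg; exact: ltnW.
exact: (expected_uncertainty_cvg0 hPi_neg hf_rank ha hsigma hW_mem hW_indep hW_unif
  Gam_mem hconv hz0 hz).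
Qed.
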